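(* For any $1\le r\le\infty$ and $s\in\mathbb{R}$, the flow map $S:\hat H^s_r(\mathbb{T})\times(-T,T)\to\hat H^s_r(\mathbb{T})$ (for any $T>0$) of the Cauchy problem, with $u(t=0)=u_0$, for the fourth-order NLS hierarchy equation ($j=2$) $$i\partial_tu-\partial_x^4u=-2u^2\partial_x^2\overline{u}-8|u|^2\partial_x^2u-4|\partial_xu|^2u-6(\partial_xu)^2\overline{u}+6|u|^4u$$ on the torus $\mathbb{T}$ cannot be three times continuously differentiable.
   Context: $\mathbb{T}=\mathbb{R}/2\pi\mathbb{Z}$, $\langle k\rangle=(1+k^2)^{1/2}$, $\frac1r+\frac1{r'}=1$. $\hat H^s_r(\mathbb{T})$ is the space of periodic distributions $u$ with $\|u\|_{\hat H^s_r}=\|\langle k\rangle^s\hat u(k)\|_{\ell^{r'}_k(\mathbb{Z})}<\infty$, where $\hat u(k)$ are the Fourier coefficients. The flow map is $S(u_0,t)=u(\cdot,t)$, where $u$ is the solution with datum $u_0$. Differentiability is with respect to the initial datum $u_0\in\hat H^s_r(\mathbb{T})$ (Fréchet sense), for fixed $t\neq0$. *)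

(* Defs.v *)
From HB Require Import structures.
From mathcomp Require Import all_boot all_order all_algebra.
From mathcomp Require Import all_classical all_reals all_analysis.
From mathcomp Require Import ess_sup_inf complex.
Set Implicit Arguments.
Unset Strict Implicit.
Unset Printing Implicit Defensive.
Import Order.TTheory GRing.Theory Num.Theory.
Import numFieldNormedType.Exports.
Local Open Scope classical_set_scope.
Local Open Scope ring_scope.

HB.instance Definition _ (R : realType) :=
  PseudoMetric.copy (Rcomplex R) (pseudoMetric_normed (Rcomplex R)).
HB.instance Definition _ (R : realType) := isPointed.Build (Rcomplex R) 0.
HB.instance Definition _ (R : realType) :=
  NormedZmod_PseudoMetric_eq.Build R (Rcomplex R) erefl.

Lemma Rcomplex_normrZ (R : realType) (l : R) (x : Rcomplex R) :
  `|l *: x| = `|l| * `|x|.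
Proof.
case: x => a b; rewrite /Num.norm/= /Normc.normc/=.
by rewrite !exprMn -mulrDr sqrtrM ?sqr_ge0// sqrtr_sqr.
Qed.

HB.instance Definition _ (R : realType) :=
  PseudoMetricNormedZmod_Lmodule_isNormedModule.Build R (Rcomplex R)
    (@Rcomplex_normrZ R).

HB.instance Definition _ := isPointed.Build int 0.
HB.instance Definition _ := @isMeasurable.Build default_measure_display
  int discrete_measurable discrete_measurable0
  discrete_measurableC discrete_measurableU.

Section BoundedLinear.
Context {R : realType} {V W : normedModType R}.

Definition blin_pred : {pred V -> W} :=
  fun f => `[< linear f /\ exists c : R, forall v, `|f v| <= c * `|v| >].

Record blin := Blin { blin_val :> V -> W; _ : blin_val \in blin_pred }.

HB.instance Definition _ := [isSub for blin_val].
HB.instance Definition _ := [Choice of blin by <:].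

Lemma blin_submod_closed : submod_closed blin_pred.
Proof.
split; first by apply/asboolP; split=> [a x y|];
  [rewrite /= scaler0 addr0 | exists 0 => v; rewrite normr0 mul0r].
move=> a f g /asboolP[lf [c fc]] /asboolP[lg [d gd]]; apply/asboolP; split.
  move=> b x y; rewrite -[LHS]/(a *: f (b *: x + y) + g (b *: x + y)).
  rewrite -[RHS]/(b *: (a *: f x + g x) + (a *: f y + g y)) lf lg.
  by rewrite !scalerDr !scalerA (mulrC b) addrACA.
exists (`|a| * c + d) => v; rewrite mulrDl (le_trans (ler_normD _ _))//.
by rewrite lerD// normrZ -mulrA ler_wpM2l.
Qed.

HB.instance Definition _ := GRing.isSubmodClosed.Build R (V -> W) blin_pred
  blin_submod_closed.
HB.instance Definition _ := [SubChoice_isSubLmodule of blin by <:].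

Definition opnorm (f : blin) : R := sup [set `|f v| | v in [set v | `|v| <= 1]].

Lemma blin_linear (f : blin) : linear f.
Proof. by case: f => f /= /asboolP[]. Qed.

Lemma blin0 (f : blin) : f 0 = 0.
Proof. by have := blin_linear f (-1) 0 0; rewrite scaler0 addr0 scaleN1r addNr. Qed.

Lemma blinZ (f : blin) a v : f (a *: v) = a *: f v.
Proof. by have := blin_linear f a v 0; rewrite blin0 !addr0. Qed.

Lemma opnorm_has_sup (f : blin) :
  has_sup [set `|f v| | v in [set v | `|v| <= 1]].
Proof.
split; first by exists `|f 0|, 0 => //=; rewrite normr0 ler01.
case: f => f /= /asboolP[_ [c fc]]; exists `|c| => _ [v /= v1 <-].
rewrite (le_trans (fc v))// (le_trans (ler_wpM2r _ (ler_norm c)))//.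
by rewrite ler_piMr.
Qed.

Lemma opnorm_ge0 f : 0 <= opnorm f.
Proof.
rewrite -(@normr0 _ W) -(blin0 f); apply: (ub_le_sup (opnorm_has_sup f).2).
by exists 0 => //=; rewrite normr0 ler01.
Qed.

Lemma le_opnorm (f : blin) v : `|f v| <= opnorm f * `|v|.
Proof.
have [->|v0] := eqVneq v 0; first by rewrite blin0 !normr0 mulr0.
have nv0 : 0 < `|v| by rewrite normr_gt0.
rewrite -ler_pdivrMr// -[_^-1]ger0_norm ?invr_ge0// mulrC -normrZ -blinZ.
apply: (ub_le_sup (opnorm_has_sup f).2); exists (`|v|^-1 *: v) => //=.
by rewrite normrZ ger0_norm ?invr_ge0// mulVf ?gt_eqF.
Qed.

Lemma opnorm_le (f : blin) c :
  0 <= c -> (forall v, `|f v| <= c * `|v|) -> opnorm f <= c.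
Proof.
move=> c0 fc; apply: sup_le_ub; first exact: (opnorm_has_sup f).1.
by move=> _ [v /= v1 <-]; rewrite (le_trans (fc v))// ler_piMr.
Qed.

Lemma opnormD f g : opnorm (f + g) <= opnorm f + opnorm g.
Proof.
apply: opnorm_le; first by rewrite addr_ge0 ?opnorm_ge0.
by move=> v; rewrite mulrDl (le_trans (ler_normD _ _))// lerD ?le_opnorm.
Qed.

Lemma opnorm0_eq0 f : opnorm f = 0 -> f = 0.
Proof.
move=> f0; apply/val_inj/funext => v; apply/normr0_eq0/eqP.
by rewrite eq_le normr_ge0 andbT (le_trans (le_opnorm f v))// f0 mul0r.
Qed.

Lemma opnormZ a f : opnorm (a *: f) = `|a| * opnorm f.
Proof.
have le_ b g : opnorm (b *: g) <= `|b| * opnorm g.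
  apply: opnorm_le; first by rewrite mulr_ge0 ?opnorm_ge0.
  by move=> v; rewrite normrZ -mulrA ler_wpM2l ?le_opnorm.
have [->|a0] := eqVneq a 0.
  by apply/eqP; rewrite eq_le le_ normr0 mul0r opnorm_ge0.
apply/eqP; rewrite eq_le le_ -ler_pdivlMl ?normr_gt0//.
by rewrite -normfV (le_trans _ (le_ _ _))// scalerA mulVf// scale1r.
Qed.

HB.instance Definition _ := Lmodule_isNormed.Build R blin
  opnormD opnormZ opnorm0_eq0.

End BoundedLinear.
Arguments blin {R} V W.

(* Fréchet differentiability and the derivative ['d f x] are the library's;
   each successive derivative takes values in the space of bounded linear maps
   with the operator norm. All spaces are real: a flow whose equation involves
   complex conjugates has no reason to be complex differentiable. *)
Fixpoint Cn {R : realType} {V : normedModType R} (n : nat)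
    {W : normedModType R} (f : V -> W) {struct n} : Prop :=
  match n with
  | 0 => continuous f
  | m.+1 => (forall x, differentiable f x) /\
            exists Df : V -> blin V W,
              (forall x, Df x = 'd f x :> (V -> W)) /\ Cn m Df
  end.

Section FourierLebesgue.
Context {R : realType}.
Local Notation C := (Rcomplex R).

Definition bracket (k : int) : R := Num.sqrt (1 + k%:~R ^+ 2).

Definition weight (s : R) (a : int -> C) (k : int) : R :=
  bracket k `^ s * `|a k|.

(* [r] is the exponent in the name of the space; the summability exponent is
   its conjugate r'. For r = 1 this is the supremum over k, as the empty set is
   the only null set of the counting measure. *)
Definition FL_norm (s : R) (r : \bar R) (a : int -> C) : \bar R :=
  'N[@counting int R]_(hoelder_conjugate r) [EFin \o weight s a].

(* A periodic distribution is represented by its Fourier coefficients;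
   finiteness of the norm bounds these by a power of k, so that every sequence
   in [FL_pred] is the coefficient sequence of a unique distribution. *)
Definition FL_pred (s : R) (r : \bar R) : {pred int -> C} :=
  fun a => (FL_norm s r a < +oo)%E.

Record FL (s : R) (r : \bar R) (r1 : (1 <= r)%E) :=
  MkFL { FL_val :> int -> C; _ : FL_val \in FL_pred s r }.

Section Norm.
Context (s : R) (r : \bar R) (r1 : (1 <= r)%E).
Local Notation X := (FL s r1).

HB.instance Definition _ := [isSub for @FL_val s r r1].
HB.instance Definition _ := [Choice of X by <:].

Let p1 := hoelder_conj_ge1 r1.

Let le_Lnorm (p : \bar R) (f g : int -> R) : (1 <= p)%E ->
  (forall k, `|f k| <= `|g k|) ->
  ('N[@counting int R]_p [EFin \o f] <= 'N[@counting int R]_p [EFin \o g])%E.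
Proof.
case: p => // [p|] p1' fg; rewrite unlock.
- have p0 : 0 <= p by rewrite (le_trans ler01).
  apply: gt0_ler_poweR; first by rewrite invr_ge0.
  + by rewrite in_itv/= leey andbT; apply: integral_ge0 => k _; rewrite lee_fin powR_ge0.
  + by rewrite in_itv/= leey andbT; apply: integral_ge0 => k _; rewrite lee_fin powR_ge0.
  + apply: ge0_le_integral => //= k _; rewrite lee_fin.
    by rewrite ge0_ler_powR// ?nnegrE.
- by case: ifPn => // _; apply: le_ess_sup; apply/nearW => k /=; rewrite lee_fin.
Qed.

Let weightD a b k : `|weight s (a + b) k| <= `|weight s a k + weight s b k|.
Proof.
rewrite /weight -!mulrDr !normrM ler_wpM2l// !ger0_norm ?addr_ge0//.
exact: ler_normD.
Qed.

Let weightZ l a : weight s (l *: a) = `|l| \*: weight s a.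
Proof. by apply/funext => k; rewrite /weight/= normrZ mulrCA. Qed.

Lemma FL_normD a b : (FL_norm s r (a + b)%R <= FL_norm s r a + FL_norm s r b)%E.
Proof.
apply: (le_trans (le_Lnorm p1 (weightD a b))).
exact: (@eminkowski _ _ _ _ (weight s a) (weight s b)).
Qed.

Lemma FL_normZ l a : a \in FL_pred s r ->
  FL_norm s r (l *: a) = (`|l|%:E * FL_norm s r a)%E.
Proof.
rewrite unfold_in => aN.
have wa : weight s a \in Lfun (@counting int R) (hoelder_conjugate r).
  by apply/andP; rewrite !inE.
by rewrite /FL_norm weightZ (LnormZ (Lfun_Sub p1 wa)) normr_id.
Qed.

Lemma FL_norm_eq0 a : FL_norm s r a = 0%E -> a = 0.
Proof.
have p0 : (0 < hoelder_conjugate r)%E by exact: lt_le_trans p1.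
move=> /Lnorm_eq0_eq0 => /(_ _ p0)[//|A [_ A0 wA]]; apply/funext => k.
have {}A0 : A = set0.
  move: A0; rewrite /= /counting; case: asboolP => [fA|//] /eqP.
  by rewrite eqe pnatr_eq0 finmap.cardfs_eq0 => /eqP; exact: fset_set_set0.
have /(_ I)[] : setT k -> (EFin \o weight s a) k = 0%E.
  by apply: contrapT => /wA; rewrite A0.
move=> /eqP; rewrite /weight mulf_eq0 gt_eqF/=; last first.
  by rewrite powR_gt0// /bracket sqrtr_gt0 ltr_pwDl ?sqr_ge0.
by rewrite normr_eq0 => /eqP.
Qed.

Lemma FL_submod_closed : submod_closed (FL_pred s r).
Proof.
split.
  rewrite unfold_in /FL_norm (_ : weight s 0 = cst 0).
    by rewrite Lnorm0// gt_eqF// (lt_le_trans _ p1).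
  by apply/funext => k; rewrite /weight normr0 mulr0.
move=> l a b aN bN; rewrite unfold_in (le_lt_trans (FL_normD _ _))//.
by rewrite FL_normZ// lte_add_pinfty// lte_mul_pinfty.
Qed.

HB.instance Definition _ := GRing.isSubmodClosed.Build R (int -> C)
  (FL_pred s r) FL_submod_closed.
HB.instance Definition _ := [SubChoice_isSubLmodule of X by <:].

Let norm (a : X) : R := fine (FL_norm s r (a : int -> C)).

Let normE a : (norm a)%:E = FL_norm s r (a : int -> C).
Proof. by rewrite /norm fineK// ge0_fin_numE ?Lnorm_ge0//; exact: (valP a). Qed.

Let normD a b : norm (a + b) <= norm a + norm b.
Proof. by rewrite -lee_fin EFinD !normE FL_normD. Qed.

Let normZ l a : norm (l *: a) = `|l| * norm a.
Proof. by apply: EFin_inj; rewrite EFinM !normE FL_normZ//; exact: (valP a). Qed.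

Let norm0_eq0 a : norm a = 0 -> a = 0.
Proof.
by move=> a0; apply/val_inj/FL_norm_eq0; rewrite -normE a0.
Qed.

HB.instance Definition _ := Lmodule_isNormed.Build R X normD normZ norm0_eq0.

End Norm.
End FourierLebesgue.

Section FourthOrderNLS.
Context {R : realType}.
Local Notation C := (Rcomplex R).
Local Notation "z ^*" := (conjc z : C).

Definition expi (x : R) : C := (cos x +i* sin x)%C.

Definition cintegral (D : set R) (f : R -> C) : C :=
  (\int[lebesgue_measure]_(x in D) complex.Re (f x)
   +i* \int[lebesgue_measure]_(x in D) complex.Im (f x))%C.

Definition fourier_coef (f : R -> C) (k : int) : C :=
  (2 * pi)^-1 *:
    cintegral `[0, 2 * pi] (fun x => f x * expi (- (k%:~R * x))).

Definition periodic (f : R -> C) : Prop := forall x, f (x + 2 * pi) = f x.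

Definition smooth (f : R -> C) : Prop :=
  forall n x, derivable (derive1n n f) x 1.

Definition nls4_nonlin (f : R -> C) (x : R) : C :=
  - 2 * f x ^+ 2 * derive1n 2 (fun y => (f y)^*) x
  - 8 * (`|f x| ^+ 2 *: derive1n 2 f x)
  - 4 * (`|derive1 f x| ^+ 2 *: f x)
  - 6 * derive1 f x ^+ 2 * (f x)^*
  + 6 * (`|f x| ^+ 4 *: f x).

Definition nls4 (u : R -> R -> C) (t x : R) : Prop :=
  'i%C * derive1 (u ^~ x) t - derive1n 4 (u t) x = nls4_nonlin (u t) x.

Definition strip (T : R) : set (R * R) := [set z | `|z.1| < T].

Definition classical_solution (T : R) (u : R -> R -> C) : Prop :=
  [/\ forall t, `|t| < T -> periodic (u t),
      forall t x, `|t| < T -> derivable (u ^~ x) t 1 /\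
        forall j, (j < 4)%N -> derivable (derive1n j (u t)) x 1,
      {within strip T, continuous (fun z => derive1 (u ^~ z.2) z.1)},
      forall j, (j <= 4)%N ->
        {within strip T, continuous (fun z => derive1n j (u z.1) z.2)}
    & forall t x, `|t| < T -> nls4 u t x].

(* For small s the nonlinearity has no meaning on a general element of the
   space. The equation is therefore imposed on the trajectories of smooth data,
   in the classical sense; on the other data [S] is only required to satisfy
   the initial condition. *)
Definition flow_map (s : R) (r : \bar R) (r1 : (1 <= r)%E) (T : R)
    (S : FL s r1 -> R -> FL s r1) : Prop :=
  (forall u0, S u0 0 = u0) /\
  forall (phi : R -> C) (u0 : FL s r1), smooth phi -> periodic phi ->
    u0 =1 fourier_coef phi ->
    exists u : R -> R -> C,
      [/\ classical_solution T u, u 0 = phi &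
          forall t, `|t| < T -> S u0 t =1 fourier_coef (u t)].

End FourthOrderNLS.
Arguments flow_map {R} s r r1 T S.

(* Main.v *)
Require Import Defs.
From mathcomp Require Import all_boot all_order all_algebra.
From mathcomp Require Import all_classical all_reals all_analysis.
From mathcomp Require Import ess_sup_inf complex ring lra.
Set Implicit Arguments.
Unset Strict Implicit.
Unset Printing Implicit Defensive.
Import Order.TTheory GRing.Theory Num.Theory.
Import numFieldNormedType.Exports.
Local Open Scope classical_set_scope.
Local Open Scope ring_scope.

(* For the datum [e (1 + b exp(inx))] the mass [int |u|^2] and the defocusing
   energy [int |u_x|^2 + |u|^4] are conserved by every classical solution, which
   keeps it [O(e)] in [H^1]. The cubic terms, integrated by parts so as to carry
   first derivatives only, then move the Fourier modes [0] and [n] of the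
   solution by [O(e^3)], and conservation forces the solution to stay at distance
   [O(e^2)] in [H^1] from the linear wave. Substituting the linear wave in the
   cubic terms, the interactions [0 - 0 + n] and [n - n + n] are resonant, so
   that the [n]-th coefficient at time [t] is
   [exp(-i n^4 t) (e b - i t e^3 (8 n^2 b + 12 n^2 b^3)) + O(e^4)].
   If the flow were C^3, third differences at the origin would bound the
   coefficient of [e^3] by [K |datum|^3 <n>^-s] with [K] independent of [n]; for
   [b = <n>^-s] this contradicts [n^2 -> oo]. *)

(** * Differentiation of real functions *)

(** A classical solution comes with no estimate in the Fourier-Lebesgue norm, and the cubic terms
    carry two derivatives. After one integration by parts, however, every cubic monomial keeps a
    factor without derivative and no factor has more than one: sup norm times [H^1] energy bounds
    it. The distance to the linear wave is not obtained from an equation for the difference: its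
    square is expanded, and the cross terms are modes. Only the [K] and [d] supplied by
    differentiability are independent of [n]; every other constant may grow with [n]. This is
    harmless, because the order of choice is [K] and [d], then [n], then the error constant, then
    [e]. The coefficient is read after undoing the linear rotation, and only its imaginary part is
    kept: the contribution [e b] of the datum is real and disappears, so that [e^3] is the leading
    order. The two resonant contributions have the same sign and cannot cancel. A single frequency
    has the same norm in every [l^p], hence one argument covers all [r]. *)

Section RealDerivative.
Context {R : realType}.
Implicit Types f g : R -> R.

Lemma is_derive_continuous f (x df : R) :
  is_derive x 1 f df -> {for x, continuous f}.
Proof. by case=> fx _; apply/differentiable_continuous/derivable1_diffP. Qed.

Lemma is_derive_congr f (x df dg : R) :
  is_derive x 1 f df -> df = dg -> is_derive x 1 f dg.
Proof. by move=> + <-. Qed.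

Lemma is_derive_addf f g (x df dg : R) : is_derive x 1 f df ->
  is_derive x 1 g dg -> is_derive x 1 (fun y => f y + g y) (df + dg).
Proof. exact: is_deriveD. Qed.

Lemma is_derive_subf f g (x df dg : R) : is_derive x 1 f df ->
  is_derive x 1 g dg -> is_derive x 1 (fun y => f y - g y) (df - dg).
Proof. exact: is_deriveB. Qed.

Lemma is_derive_oppf f (x df : R) : is_derive x 1 f df ->
  is_derive x 1 (fun y => - f y) (- df).
Proof. exact: is_deriveN. Qed.

Lemma is_derive_mulf f g (x df dg : R) : is_derive x 1 f df ->
  is_derive x 1 g dg -> is_derive x 1 (fun y => f y * g y) (f x * dg + g x * df).
Proof. exact: is_deriveM. Qed.

Lemma is_derive_cstf (a x : R) : is_derive x 1 (fun _ : R => a) 0.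
Proof. exact: is_derive_cst. Qed.

Lemma is_derive_affine (a b x : R) : is_derive x 1 (fun y : R => a * y + b) a.
Proof.
have /is_derive_congr := is_derive_addf
  (is_derive_mulf (is_derive_cstf a x) (is_derive_id x 1)) (is_derive_cstf b x).
by apply; rewrite mulr1 mulr0 !addr0.
Qed.

Lemma is_derive_compf f g (x df dg : R) : is_derive x 1 g dg ->
  is_derive (g x) 1 f df -> is_derive x 1 (fun y => f (g y)) (df * dg).
Proof. by move=> ? ?; apply: (@is_derive1_comp _ f g). Qed.

(** [m] is the expected speed: zero for conserved quantities and for crude drift bounds, the
    resonant speed in the final asymptotics. A bound on the derivative that is uniform in time
    replaces any integration in time. *)
Lemma mean_value_bound (f df : R -> R) (T m B t : R) :
  (forall x : R, `|x| < T -> is_derive x 1 f (df x)) ->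
  (forall x : R, `|x| < T -> `|df x - m| <= B) ->
  `|t| < T -> `|f t - f 0 - m * t| <= B * `|t|.
Proof.
move=> fdf dfB tT.
have T0 : 0 < T by rewrite (le_lt_trans _ tT).
have seg (c : R) : `|c| <= `|t| -> `|c| < T by move/le_lt_trans; apply.
have B0 : 0 <= B by rewrite (le_trans _ (dfB 0 _))// normr0.
have [t0|t0] := leP 0 t.
- have [||c cI e] := @MVT_segment _ f df 0 t t0.
  + move=> x; rewrite in_itv/= => /andP[x0 xt]; apply: fdf; apply: seg.
    by rewrite !ger0_norm// ltW.
  + apply: continuous_in_subspaceT => x; rewrite inE/= in_itv/= => /andP[x0 xt].
    by apply: (is_derive_continuous (fdf x _)); apply: seg; rewrite !ger0_norm// ltW.
  move: cI; rewrite in_itv/= => /andP[c0 ct].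
  rewrite e subr0 -mulrBl normrM ler_wpM2r// dfB// seg// !ger0_norm//.
- have [||c cI e] := @MVT_segment _ f df t 0 (ltW t0).
  + move=> x; rewrite in_itv/= => /andP[x0 xt]; apply: fdf; apply: seg.
    by rewrite !ltr0_norm// lerN2 ltW.
  + apply: continuous_in_subspaceT => x; rewrite inE/= in_itv/= => /andP[x0 xt].
    apply: (is_derive_continuous (fdf x _)); apply: seg.
    by rewrite ler0_norm// ltr0_norm// lerN2.
  move: cI; rewrite in_itv/= => /andP[c0 ct].
  have -> : f t - f 0 - m * t = (df c - m) * t.
    by rewrite -(opprB (f 0)) e; ring.
  by rewrite normrM ler_wpM2r// dfB// seg// ler0_norm// ltr0_norm// lerN2.
Qed.

(** The mean value theorem is used three times. The left side involves only values of [g0], so it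
    can be compared with an asymptotic expansion of the flow without differentiating that
    expansion. *)
Lemma third_difference (g0 g1 g2 g3 : R -> R) (e : R) : 0 <= e ->
  (forall x : R, is_derive x 1 g0 (g1 x)) -> (forall x : R, is_derive x 1 g1 (g2 x)) ->
  (forall x : R, is_derive x 1 g2 (g3 x)) ->
  exists2 z, 0 <= z <= 3 * e &
    g0 (3 * e) - 3 * g0 (2 * e) + 3 * g0 e - g0 0 = g3 z * e ^+ 3.
Proof.
move=> e0 d0 d1 d2.
have mvt (f df : R -> R) (a : R) : (forall x : R, is_derive x 1 f (df x)) ->
    exists2 c, a <= c <= a + e & f (a + e) - f a = df c * e.
  move=> fdf; have ae : a <= a + e by rewrite lerDl.
  have [|c] := @MVT_segment _ f df a (a + e) ae (fun x _ => fdf x).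
    by apply: continuous_in_subspaceT => x _; exact: is_derive_continuous (fdf x).
  by rewrite in_itv/= => cI ->; exists c => //; rewrite addrAC subrr add0r.
have sh (f df : R -> R) (b : R) : (forall x : R, is_derive x 1 f (df x)) ->
    forall x : R, is_derive x 1 (fun y => f (1 * y + b)) (df (1 * x + b)).
  move=> fdf x; rewrite -[X in is_derive _ _ _ X]mulr1.
  exact: (is_derive_compf (is_derive_affine 1 b x) (fdf _)).
(* The function here is the second difference [g0 (x + 2e) - 2 g0 (x + e) + g0 x], whose increment
   from [0] to [e] is the third difference. *)
have [a /andP[a0 ae] Ea] := mvt _ _ 0 (fun x => is_derive_addf
  (is_derive_subf (sh _ _ (e + e) d0 x) (is_derive_addf (sh _ _ e d0 x) (sh _ _ e d0 x))) (d0 x)).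
have [b /andP[b0 be] Eb] := mvt _ _ a (fun x => is_derive_subf (sh _ _ e d1 x) (d1 x)).
have [c /andP[c0 ce] Ec] := mvt _ _ b d2.
exists c; first by apply/andP; split; lra.
move: Ea Eb Ec; rewrite /= !mul1r !add0r => Ea Eb Ec.
rewrite [RHS](_ : _ = g3 c * e * e * e); last by ring.
rewrite -Ec; move: Eb.
rewrite -!addrA (_ : a + (e + e) = a + (e + e)) // => Eb.
have -> : (g2 (b + e) - g2 b) * e = g1 (a + (e + e)) - (g1 (a + e) + g1 (a + e)) + g1 a.
  by rewrite -Eb; ring.
rewrite -Ea; rewrite (_ : 3 * e = e + (e + e)); last by ring.
by rewrite (_ : 2 * e = e + e); ring.
Qed.

End RealDerivative.

(** * Integrals over a period *)

Section PeriodIntegral.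
Context {R : realType}.
Implicit Types (f g df F : R -> R) (a b c x y : R).
Local Notation mu := (@lebesgue_measure R).

Definition period_integral f : R := \int[mu]_(x in `[0, 2 * pi]) f x.
Local Notation "'\oint' f" := (period_integral f) (at level 10, f at next level).

Lemma twopi_gt0 : 0 < 2 * pi :> R.
Proof. by rewrite mulr_gt0// pi_gt0. Qed.

Lemma continuous_integrable f : continuous f ->
  mu.-integrable `[0, 2 * pi] (EFin \o f).
Proof.
move=> cf; apply: continuous_compact_integrable; first exact: segment_compact.
exact: continuous_subspaceT.
Qed.

Lemma eq_period_integral f g : (forall x, f x = g x) -> \oint f = \oint g.
Proof. by move=> fg; apply: eq_Rintegral => x _; exact: fg. Qed.

Lemma period_integralD f g : continuous f -> continuous g ->
  \oint (fun x => f x + g x) = \oint f + \oint g.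
Proof. by move=> cf cg; apply: RintegralD => //; exact: continuous_integrable. Qed.

Lemma period_integralB f g : continuous f -> continuous g ->
  \oint (fun x => f x - g x) = \oint f - \oint g.
Proof. by move=> cf cg; apply: RintegralB => //; exact: continuous_integrable. Qed.

Lemma period_integralZ c f : continuous f ->
  \oint (fun x => c * f x) = c * \oint f.
Proof. by move=> cf; apply: RintegralZl => //; exact: continuous_integrable. Qed.

Lemma period_integral_cst c : \oint (fun _ => c) = c * (2 * pi).
Proof.
rewrite /period_integral Rintegral_cst//= lebesgue_measure_itv/= lte_fin.
by rewrite twopi_gt0/= oppr0 addr0.
Qed.

Lemma le_period_integral f g : continuous f -> continuous g ->
  (forall x, 0 <= x <= 2 * pi -> f x <= g x) -> \oint f <= \oint g.
Proof.
move=> cf cg fg; apply: le_Rintegral => //; exact: continuous_integrable.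
Qed.

Lemma period_integral_ge0 f : (forall x, 0 <= f x) -> 0 <= \oint f.
Proof. by move=> f0; apply: Rintegral_ge0 => x _; exact: f0. Qed.

Lemma le_norm_period_integral f g : continuous f -> continuous g ->
  (forall x, 0 <= x <= 2 * pi -> `|f x| <= g x) -> `|\oint f| <= \oint g.
Proof.
move=> cf cg fg; have cn : continuous (fun x => `|f x|).
  by move=> x; apply: continuous_comp; [exact: cf|exact: norm_continuous].
apply: (le_trans (le_normr_Rintegral _ _)) => //; first exact: continuous_integrable.
exact: le_period_integral.
Qed.

Lemma integral_is_derive F f a b : a <= b ->
  (forall x, is_derive x 1 F (f x)) -> continuous f ->
  \int[mu]_(x in `[a, b]) f x = F b - F a.
Proof.
rewrite le_eqVlt => /orP[/eqP <- _ _|ab dF cf].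
  by rewrite set_itv1 Rintegral_set1 subrr.
have cF : continuous F by move=> x; exact: is_derive_continuous (dF x).
rewrite /Rintegral (@continuous_FTC2 _ f F)//.
- exact: continuous_subspaceT.
- split; first by move=> x _; case: (dF x).
  + exact: cvg_at_right_filter (cF a).
  + exact: cvg_at_left_filter (cF b).
- by move=> x _; rewrite derive1E; case: (dF x).
Qed.

Lemma period_integral_derive F f : (forall x, is_derive x 1 F (f x)) ->
  continuous f -> F (2 * pi) = F 0 -> \oint f = 0.
Proof.
move=> dF cf F0; rewrite /period_integral (integral_is_derive _ dF cf) ?F0 ?subrr//.
exact: ltW twopi_gt0.
Qed.

(* The function [y |-> f y ^+ 2] varies on a period by at most the integral of
   [2 f f'], hence of [f ^+ 2 + f' ^+ 2]; average over [y]. *)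
Lemma sobolev_sup f df x : (forall y, is_derive y 1 f (df y)) ->
  continuous df -> 0 <= x <= 2 * pi ->
  f x * f x * (2 * pi) <= \oint (fun y => f y * f y) +
    \oint (fun y => f y * f y + df y * df y) * (2 * pi).
Proof.
move=> dfE cdf /andP[x0 x1].
have cf : continuous f by move=> y; exact: is_derive_continuous (dfE y).
have cff : continuous (fun y => f y * f y) by move=> y; apply: cvgM; exact: cf.
have cg : continuous (fun y => f y * f y + df y * df y).
  by move=> y; apply: cvgD; apply: cvgM; (exact: cf || exact: cdf).
have dff y : is_derive y 1 (fun y => f y * f y) (2 * (f y * df y)).
  by have /is_derive_congr := is_derive_mulf (dfE y) (dfE y); apply; ring.
have c2 : continuous (fun y => 2 * (f y * df y)).
  by move=> y; apply: cvgM; [exact: cvg_cst|apply: cvgM; [exact: cf|exact: cdf]].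
have cn2 : continuous (fun y => `|2 * (f y * df y)|).
  by move=> y; apply: cvg_norm; exact: c2.
set I := \oint (fun y => f y * f y + df y * df y).
have var a b : 0 <= a -> a <= b -> b <= 2 * pi ->
    `|f b * f b - f a * f a| <= I.
  move=> a0 ab b1; rewrite -(integral_is_derive ab dff c2).
  have int_ab h : continuous h -> mu.-integrable `[a, b] (EFin \o h).
    move=> ch; apply: continuous_compact_integrable; first exact: segment_compact.
    exact: continuous_subspaceT.
  apply: (le_trans (le_normr_Rintegral _ (int_ab _ c2))) => //.
  apply: (@le_trans _ _ (\int[mu]_(y in `[a, b]) (f y * f y + df y * df y))).
    apply: le_Rintegral => //; [|exact: int_ab|].
      exact: (int_ab _ cn2).
    move=> y _; rewrite ler_norml; apply/andP; split.
      have := sqr_ge0 (f y + df y); rewrite expr2; lra.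
    have := sqr_ge0 (f y - df y); rewrite expr2; lra.
  rewrite /I /period_integral /Rintegral; apply: fine_le.
  - by apply: integrable_fin_num => //; exact: int_ab.
  - by apply: integrable_fin_num => //; exact: continuous_integrable.
  apply: ge0_subset_integral => //=.
  - by have /integrableP[] := continuous_integrable cg.
  - by move=> y _; rewrite lee_fin addr_ge0// -expr2 sqr_ge0.
  - by apply: subset_itv; rewrite bnd_simp.
rewrite -!period_integral_cst -period_integralD//; last by move=> ?; exact: cvg_cst.
apply: le_period_integral => [y|y|y /andP[y0 y1]]; first exact: cvg_cst.
  by apply: cvgD; [exact: cff|exact: cvg_cst].
rewrite -lerBlDl; have [xy|/ltW yx] := leP x y.
  by rewrite (le_trans _ (var x y x0 xy y1))// distrC ler_norm.
by rewrite (le_trans _ (var y x y0 yx x1))// ler_norm.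
Qed.

End PeriodIntegral.

(** * Differentiation under the integral *)

Section TimeDerivative.
Context {R : realType}.
Implicit Types (v vt w : R -> R -> R) (t x T h : R).
Local Notation "'\oint' f" := (period_integral f) (at level 10, f at next level).

Definition strip_continuous T (v : R -> R -> R) :=
  forall t x, `|t| < T -> {for (t, x), continuous (fun z : R * R => v z.1 z.2)}.

Lemma strip_continuous_snd T v t : strip_continuous T v -> `|t| < T ->
  continuous (v t).
Proof.
move=> cv tT x.
apply: (@continuous_comp _ _ _ (fun y => (t, y)) (fun z : R * R => v z.1 z.2)).
  exact: (cvg_pair (cvg_cst _) cvg_id).
exact: cv.
Qed.

Lemma strip_continuous_fst T v t x : strip_continuous T v -> `|t| < T ->
  {for t, continuous (v ^~ x)}.
Proof.
move=> cv tT.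
apply: (@continuous_comp _ _ _ (fun y => (y, x)) (fun z : R * R => v z.1 z.2)).
  exact: (cvg_pair cvg_id (cvg_cst _)).
exact: cv.
Qed.

Lemma strip_continuousD T v w : strip_continuous T v -> strip_continuous T w ->
  strip_continuous T (fun t x => v t x + w t x).
Proof. by move=> cv cw t x tT; apply: cvgD; [exact: cv|exact: cw]. Qed.

Lemma strip_continuousB T v w : strip_continuous T v -> strip_continuous T w ->
  strip_continuous T (fun t x => v t x - w t x).
Proof. by move=> cv cw t x tT; apply: cvgB; [exact: cv|exact: cw]. Qed.

Lemma strip_continuousM T v w : strip_continuous T v -> strip_continuous T w ->
  strip_continuous T (fun t x => v t x * w t x).
Proof. by move=> cv cw t x tT; apply: cvgM; [exact: cv|exact: cw]. Qed.

Lemma strip_continuousN T v : strip_continuous T v ->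
  strip_continuous T (fun t x => - v t x).
Proof. by move=> cv t x tT; apply: cvgN; exact: cv. Qed.

Lemma strip_continuous_space T f : continuous f ->
  strip_continuous T (fun _ x => f x).
Proof.
move=> cf t x _; apply: (@continuous_comp _ _ _ snd f); [exact: cvg_snd|exact: cf].
Qed.

Lemma strip_continuous_cst T (a : R) : strip_continuous T (fun _ _ => a).
Proof. by move=> t x _; exact: cvg_cst. Qed.

Lemma strip_bounded T v a : strip_continuous T v -> a < T ->
  exists M, forall t x, `|t| <= a -> 0 <= x <= 2 * pi -> `|v t x| <= M.
Proof.
move=> cv aT.
have cK : compact (`[- a, a] `*` `[0, 2 * pi] : set (R * R)).
  by apply: compact_setX; exact: segment_compact.
have cvK : {within `[- a, a] `*` `[0, 2 * pi], continuous (fun z : R * R => v z.1 z.2)}.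
  apply: continuous_in_subspaceT => -[t x]; rewrite inE => -[/= + _].
  rewrite in_itv/= -ler_norml => ta.
  by apply: cv; exact: le_lt_trans aT.
have [M [_ MP]] := compact_bounded (continuous_compact cvK cK).
exists (M + 1) => t x ta x0; apply: (MP (M + 1)); first by rewrite ltrDl.
by exists (t, x) => //; split; rewrite /= in_itv/= -?ler_norml.
Qed.

(** Dominated convergence, the domination coming from the mean value theorem in time. The weight [w]
    is taken at the moving time [h + t] because the gradient energy needs a weight that depends on
    both times. *)
Lemma cvg_diff_quotient_integral T v vt w t : `|t| < T ->
  (forall s x : R, `|s| < T -> is_derive s 1 (v ^~ x) (vt s x)) ->
  strip_continuous T v -> strip_continuous T vt -> strip_continuous T w ->
  (fun h => h^-1 * \oint (fun x => (v (h + t) x - v t x) * w (h + t) x)) @ 0^'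
    --> \oint (fun x => vt t x * w t x).
Proof.
move=> tT dv cv cvt cw.
(* Half the distance to the edge of the strip: times up to [|t| + d] stay in a compact set, where
   [vt] and [w] are bounded over a period. *)
pose d := (T - `|t|) / 2.
have d0 : 0 < d by rewrite divr_gt0// subr_gt0.
have dT : `|t| + d < T by rewrite /d; lra.
have hT (h : R) : `|h| < d -> `|h + t| <= `|t| + d.
  by move=> hd; rewrite (le_trans (ler_normD _ _))// addrC lerD2l ltW.
have hT' (h : R) : `|h| < d -> `|h + t| < T by move=> /hT /le_lt_trans; exact.
have [M1 M1P] := strip_bounded cvt dT; have [M2 M2P] := strip_bounded cw dT.
have M1_ge0 : 0 <= M1.
  apply: (le_trans (normr_ge0 (vt t 0))); apply: M1P.
    by rewrite lerDl ltW.
  by rewrite lexx ltW// twopi_gt0.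
(* The integrand is completed at [h = 0] by its limit, so that the claim becomes continuity at [0]
   of an integral with parameter. *)
pose Q h x := if h == 0 then vt t x * w t x
              else h^-1 * ((v (h + t) x - v t x) * w (h + t) x).
have cQx (h : R) : `|h| < d -> continuous (Q h).
  move=> hd; rewrite /Q; case: eqP => _.
    by move=> x; apply: cvgM; [exact: (strip_continuous_snd cvt tT)
      |exact: (strip_continuous_snd cw tT)].
  move=> x; apply: cvgM; first exact: cvg_cst.
  apply: cvgM; last exact: (strip_continuous_snd cw (hT' _ hd)).
  by apply: cvgB; [exact: (strip_continuous_snd cv (hT' _ hd))
      |exact: (strip_continuous_snd cv tT)].
have shift_cvg (f : R -> R) h : {for h + t, continuous f} ->
    (fun k => f (k + t)) @ h --> f (h + t).
  move=> cf; apply: (@continuous_comp _ _ _ (fun k => k + t) f) => //.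
  by apply: cvgD; [exact: cvg_id|exact: cvg_cst].
have near_shift (f : R -> R) (h : R) : {for h + t, continuous f} ->
    {for h, continuous (fun k : R => f (k + t))} by move=> /shift_cvg.
have cQh (x h : R) : `|h| < d -> {for h, continuous (Q ^~ x)}.
  move=> hd; have cwh := strip_continuous_fst (x := x) cw (hT' _ hd).
  have [h0|h0] := eqVneq h 0.
    rewrite h0 in cwh *; apply/continuous_withinNx; rewrite {2}/Q eqxx.
    have Qe : {near 0^', (fun k => k^-1 *: (v (k *: 1 + t) x - v t x) * w (k + t) x) =1 Q ^~ x}.
      near=> k; rewrite /Q ifF.
        by rewrite mulrA /GRing.scale/= mulr1.
      by apply/negbTE; near: k; exact: nbhs_dnbhs_neq.
    apply: cvg_trans (near_eq_cvg Qe) _.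
    apply: cvgM; first by case: (dv t x tT) => + <-; exact.
    apply: cvg_trans (cvg_fmap2 (@nbhs_dnbhs _ 0)) _.
    by have := shift_cvg _ _ cwh; rewrite add0r.
  have Qe : {near h, (fun k => k^-1 * ((v (k + t) x - v t x) * w (k + t) x)) =1 Q ^~ x}.
    near=> k; rewrite /Q ifF//.
    by apply/negbTE; near: k; apply: open_nbhs_nbhs; split; [exact: open_neq|exact: h0].
  apply: cvg_trans (near_eq_cvg Qe) _.
  rewrite /Q (negbTE h0); apply: cvgM; first exact: cvgV.
  apply: cvgM; last exact: (near_shift _ _ cwh).
  apply: cvgB; last exact: cvg_cst.
  exact: (near_shift (v ^~ x) _ (strip_continuous_fst cv (hT' _ hd))).
have Qle (h x : R) : `|h| < d -> 0 <= x <= 2 * pi -> `|Q h x| <= M1 * M2.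
  move=> hd x0; rewrite /Q; case: ifPn => h0.
    have tt : `|t| <= `|t| + d by rewrite lerDl ltW.
    by rewrite normrM ler_pM// ?M1P ?M2P.
  rewrite mulrA normrM ler_pM ?M2P ?hT//.
  rewrite normrM normfV ler_pdivrMl ?normr_gt0// mulrC.
  have := @mean_value_bound R (fun k => v (1 * k + t) x) (fun k => vt (1 * k + t) x * 1) d 0 M1 h.
  rewrite !mul1r !add0r mul0r subr0; apply => //.
  - move=> k kd; apply: (is_derive_compf (f := v ^~ x)); first exact: is_derive_affine.
    by apply: dv; rewrite mul1r; exact: hT'.
  - by move=> k kd; rewrite subr0 mulr1 mul1r; apply: M1P => //; exact: hT.
have itv0 (h : R) : h \in [set` `]- d, d[] -> `|h| < d.
  by rewrite inE/= in_itv/= -ltr_norml.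
have cF : {in [set` `]- d, d[], continuous (fun h => \oint (Q h))}.
  apply: (@continuity_under_integral R _ _ lebesgue_measure Q `[0, 2 * pi]
    _ (- d) d _ _ (cst (M1 * M2))).
  - by [].
  - by move=> h /mem_set/itv0 hd; exact: continuous_integrable (cQx _ hd).
  - by apply/aeW => x _ h /itv0 hd; exact: cQh.
  - by apply: continuous_integrable => x; exact: cvg_cst.
  - move=> h /mem_set/itv0 hd; apply/aeW => x; rewrite /= in_itv/=; exact: Qle.
have I0 : (0 : R) \in [set` `]- d, d[] by rewrite inE/= in_itv/= oppr_lt0 d0.
have /continuous_withinNx := cF _ I0.
rewrite (_ : \oint (Q 0) = \oint (fun x => vt t x * w t x)); last first.
  by apply: eq_period_integral => x; rewrite /Q eqxx.
apply: cvg_trans; apply: near_eq_cvg; near=> h.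
have hd : `|h| < d by near: h; exact: dnbhs0_lt.
have h0 : h != 0 by near: h; exact: nbhs_dnbhs_neq.
rewrite -period_integralZ.
  by apply: eq_period_integral => x; rewrite /Q (negbTE h0).
move=> x; apply: cvgM; last exact: (strip_continuous_snd cw (hT' _ hd)).
by apply: cvgB; [exact: (strip_continuous_snd cv (hT' _ hd))
  |exact: (strip_continuous_snd cv tT)].
Unshelve. all: end_near. Qed.

Lemma is_derive_quotient (f : R -> R) t (l : R) :
  (fun h => h^-1 * (f (h + t) - f t)) @ 0^' --> l -> is_derive t 1 f l.
Proof.
move=> fl; have {}fl : (fun h : R => h^-1 *: (f (h *: 1 + t) - f t)) @ 0^' --> l.
  apply: cvg_trans fl; apply: near_eq_cvg; apply: nearW => h.
  by rewrite /GRing.scale/= mulr1.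
by split; [apply/cvg_ex; exists l|exact: cvg_lim fl].
Qed.

Lemma near0_strip T t : `|t| < T -> \forall h \near 0^', `|h + t| < T.
Proof.
move=> tT; near=> h; apply: (le_lt_trans (ler_normD _ _)); rewrite -ltrBrDr.
by near: h; apply: dnbhs0_lt; rewrite subr_gt0.
Unshelve. all: end_near. Qed.

Lemma is_derive_period_integral T v vt t : `|t| < T ->
  (forall s x : R, `|s| < T -> is_derive s 1 (v ^~ x) (vt s x)) ->
  strip_continuous T v -> strip_continuous T vt ->
  is_derive t 1 (fun s => \oint (v s)) (\oint (vt t)).
Proof.
move=> tT dv cv cvt; apply: is_derive_quotient.
have := cvg_diff_quotient_integral tT dv cv cvt (@strip_continuous_cst T 1).
rewrite (_ : \oint _ = \oint (vt t)); last first.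
  by apply: eq_period_integral => x; rewrite mulr1.
apply: cvg_trans; apply: near_eq_cvg; near=> h.
have hT : `|h + t| < T by near: h; exact: near0_strip.
rewrite -period_integralB; [|exact: strip_continuous_snd cv _..].
by congr (_ * _); apply: eq_period_integral => x; rewrite mulr1.
Unshelve. all: end_near. Qed.

(* No mixed derivative of [v] is assumed: the difference of the two gradient
   energies is integrated by parts in space before the limit is taken. *)
Lemma is_derive_gradient_energy T v vt vx vxx t : `|t| < T ->
  (forall s x : R, `|s| < T -> is_derive s 1 (v ^~ x) (vt s x)) ->
  (forall s x : R, `|s| < T -> is_derive x 1 (v s) (vx s x)) ->
  (forall s x : R, `|s| < T -> is_derive x 1 (vx s) (vxx s x)) ->
  (forall s, `|s| < T -> v s (2 * pi) = v s 0 /\ vx s (2 * pi) = vx s 0) ->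
  strip_continuous T v -> strip_continuous T vt ->
  strip_continuous T vx -> strip_continuous T vxx ->
  is_derive t 1 (fun s => \oint (fun x => vx s x * vx s x))
    (\oint (fun x => - 2 * (vt t x * vxx t x))).
Proof.
move=> tT dv dvx dvxx per cv cvt cvx cvxx; apply: is_derive_quotient.
(* The difference of squares of [vx] at times [s] and [t] is the product of [(v s - v t)_x] and
   [vx s + vx t]; moving the derivative off the first factor leaves this weight, with [t] frozen. At
   [s = t] it is [- 2 vxx]. *)
have cw : strip_continuous T (fun s x => - (vxx s x + vxx t x)).
  apply: strip_continuousN; apply: strip_continuousD => //.
  exact/strip_continuous_space/(strip_continuous_snd cvxx).
have := cvg_diff_quotient_integral tT dv cv cvt cw.
rewrite (_ : \oint _ = \oint (fun x => - 2 * (vt t x * vxx t x))); last first.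
  by apply: eq_period_integral => x; ring.
apply: cvg_trans; apply: near_eq_cvg; near=> h.
have hT : `|h + t| < T by near: h; exact: near0_strip.
congr (_ * _).
have cc f : strip_continuous T f -> continuous (f (h + t)) /\ continuous (f t).
  by move=> cf; split; exact: strip_continuous_snd cf _.
have [cv1 cv2] := cc _ cv; have [cvx1 cvx2] := cc _ cvx.
have [cvxx1 cvxx2] := cc _ cvxx.
have [per1 perx1] := per _ hT; have [per2 perx2] := per _ tT.
apply/eqP; rewrite -subr_eq0 -!period_integralB; last first.
- by move=> x; apply: cvgM; [exact: cvx2|exact: cvx2].
- by move=> x; apply: cvgM; [exact: cvx1|exact: cvx1].
- by move=> x; apply: cvgB; apply: cvgM; (exact: cvx1 || exact: cvx2).
- by move=> x; apply: cvgM; [apply: cvgB; [exact: cv1|exact: cv2]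
    |apply: cvgN; apply: cvgD; [exact: cvxx1|exact: cvxx2]].
apply/eqP; apply: (@period_integral_derive _
  (fun x => - ((v (h + t) x - v t x) * (vx (h + t) x + vx t x)))).
- move=> x; have /is_derive_congr := is_derive_oppf (is_derive_mulf
    (is_derive_subf (dvx _ x hT) (dvx _ x tT)) (is_derive_addf (dvxx _ x hT) (dvxx _ x tT))).
  by apply; ring.
- move=> x; apply: cvgB.
    by apply: cvgM; [apply: cvgB; [exact: cv1|exact: cv2]
      |apply: cvgN; apply: cvgD; [exact: cvxx1|exact: cvxx2]].
  by apply: cvgB; apply: cvgM; (exact: cvx1 || exact: cvx2).
- by rewrite per1 perx1 per2 perx2.
Unshelve. all: end_near. Qed.

End TimeDerivative.

(** * Conservation laws and evolution of the Fourier modes *)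

Lemma continuous_addf {R : realType} (f g : R -> R) : continuous f ->
  continuous g -> continuous (fun x => f x + g x).
Proof. by move=> cf cg x; apply: cvgD; [exact: cf|exact: cg]. Qed.

Lemma continuous_subf {R : realType} (f g : R -> R) : continuous f ->
  continuous g -> continuous (fun x => f x - g x).
Proof. by move=> cf cg x; apply: cvgB; [exact: cf|exact: cg]. Qed.

Lemma continuous_mulf {R : realType} (f g : R -> R) : continuous f ->
  continuous g -> continuous (fun x => f x * g x).
Proof. by move=> cf cg x; apply: cvgM; [exact: cf|exact: cg]. Qed.

Lemma continuous_oppf {R : realType} (f : R -> R) : continuous f ->
  continuous (fun x => - f x).
Proof. by move=> cf x; apply: cvgN; exact: cf. Qed.

Lemma continuous_cstf {R : realType} (a : R) : continuous (fun _ : R => a).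
Proof. by move=> x; exact: cvg_cst. Qed.

Ltac ctsf := lazymatch goal with
  | |- continuous (fun x => _ + - _) => apply continuous_subf; ctsf
  | |- continuous (fun x => _ + _) => apply continuous_addf; ctsf
  | |- continuous (fun x => _ * _) => apply continuous_mulf; ctsf
  | |- continuous (fun x => - _) => apply continuous_oppf; ctsf
  | |- _ => first [assumption | apply continuous_cstf | idtac]
  end.
Ltac ctss := lazymatch goal with
  | |- strip_continuous _ (fun t x => _ + - _) => apply strip_continuousB; ctss
  | |- strip_continuous _ (fun t x => _ + _) => apply strip_continuousD; ctss
  | |- strip_continuous _ (fun t x => _ * _) => apply strip_continuousM; ctss
  | |- strip_continuous _ (fun t x => - _) => apply strip_continuousN; ctss
  | |- _ => first [assumption | apply strip_continuous_cst | idtac]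
  end.
Ltac derf := lazymatch goal with
  | |- is_derive _ _ (fun x => _ + - _) _ => eapply is_derive_subf; derf
  | |- is_derive _ _ (fun x => _ + _) _ => eapply is_derive_addf; derf
  | |- is_derive _ _ (fun x => _ * _) _ => eapply is_derive_mulf; derf
  | |- is_derive _ _ (fun x => - _) _ => eapply is_derive_oppf; derf
  | |- _ => first [eassumption | eapply is_derive_cstf | idtac]
  end.

Lemma is_derive0_strip {R : realType} (f : R -> R) (T t : R) :
  (forall s : R, `|s| < T -> is_derive s 1 f 0) -> `|t| < T -> f t = f 0.
Proof.
move=> df tT; have B0 (x : R) : `|x| < T -> `|0 - 0 : R| <= 0.
  by rewrite subr0 normr0.
have := mean_value_bound df B0 tT.
by rewrite !mul0r subr0 normr_le0 subr_eq0 => /eqP.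
Qed.

Section Phase.
Context {R : realType}.

(* Phase of the plane wave of frequency [n] of the linear flow; shifting it by
   [a = pi / 2] exchanges real and imaginary parts. *)
Definition phase (n : nat) (a t x : R) : R := n%:R * x + (- n%:R ^+ 4 * t + a).

Lemma is_derive_phase_space n (a t x : R) : is_derive x 1 (phase n a t) n%:R.
Proof. exact: is_derive_affine. Qed.

Lemma is_derive_phase_time n (a t x : R) :
  is_derive t 1 (phase n a ^~ x) (- n%:R ^+ 4).
Proof.
have /is_derive_congr := is_derive_addf (is_derive_cstf (n%:R * x) t)
  (is_derive_affine (- n%:R ^+ 4) a t).
by apply; rewrite add0r.
Qed.

Lemma strip_continuous_phase T n a : strip_continuous T (@phase n a).
Proof.
have ct : strip_continuous T (fun t _ : R => t) by move=> t x _; exact: cvg_fst.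
have cx : strip_continuous T (fun _ x : R => x) by move=> t x _; exact: cvg_snd.
by rewrite /phase; ctss.
Qed.

Lemma strip_continuous_comp T f (v : R -> R -> R) : continuous f ->
  strip_continuous T v -> strip_continuous T (fun t x => f (v t x)).
Proof.
move=> cf cv t x tT.
by apply: (@continuous_comp _ _ _ (fun z => v z.1 z.2) f); [exact: cv|exact: cf].
Qed.

Lemma cos_periodn n (x : R) : cos (n%:R * (2 * pi) + x) = cos x.
Proof. by rewrite !mulr_natl addrC (periodicn (@cosD2pi R)). Qed.

Lemma sin_periodn n (x : R) : sin (n%:R * (2 * pi) + x) = sin x.
Proof. by rewrite !mulr_natl addrC (periodicn (@sinD2pi R)). Qed.

End Phase.

Section RealForm.
Context {R : realType}.
Local Notation "'\oint' f" := (period_integral f) (at level 10, f at next level).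

(* Real part of the nonlinearity at [u = a + i b]; exchanging [a] and [b] gives
   its imaginary part. *)
Definition nls4_component (a0 a1 a2 b0 b1 b2 : R) : R :=
  - 2 * ((a0 * a0 - b0 * b0) * a2 + 2 * (a0 * b0 * b2))
  - 8 * ((a0 * a0 + b0 * b0) * a2)
  - 4 * ((a1 * a1 + b1 * b1) * a0)
  - 6 * ((a1 * a1 - b1 * b1) * a0 + 2 * (a1 * b1 * b0))
  + 6 * ((a0 * a0 + b0 * b0) * (a0 * a0 + b0 * b0) * a0).

(* Real part of the cubic terms of the nonlinearity at [u = a + i b] once they
   have been tested against [exp(-ikx)] and their second derivatives integrated
   by parts; exchanging [a] and [b] and changing [k] to [- k] gives the
   imaginary part. *)
Definition cubic (k a b a1 b1 : R) : R :=
  8 * (a1 * a1 * a + b1 * b1 * a)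
  + 2 * (a1 * a1 * a - b1 * b1 * a + 2 * (a1 * b1 * b))
  + 2 * k * (2 * (a * b * a1) - (a * a * b1 - b * b * b1))
  + 8 * k * (a * a * b1 + b * b * b1).

(** Separate real and imaginary parts turn every identity below into a polynomial one, within reach
    of [ring]. Index [j] is the order of the space derivative; only [p 0] and [q 0] have a time
    derivative, as no mixed derivative of a classical solution is given. *)
Record real_solution (T : R) (p q : nat -> R -> R -> R) (pt qt : R -> R -> R) :
    Prop := RealSolution {
  rs_derive : forall j t (x : R), (j < 4)%N -> `|t| < T ->
    is_derive x 1 (p j t) (p j.+1 t x) /\ is_derive x 1 (q j t) (q j.+1 t x);
  rs_time : forall t x : R, `|t| < T ->
    is_derive t 1 (p 0%N ^~ x) (pt t x) /\ is_derive t 1 (q 0%N ^~ x) (qt t x);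
  rs_periodic : forall j t, (j < 4)%N -> `|t| < T ->
    p j t (2 * pi) = p j t 0 /\ q j t (2 * pi) = q j t 0;
  rs_continuous : forall j, (j <= 4)%N ->
    strip_continuous T (p j) /\ strip_continuous T (q j);
  rs_time_continuous : strip_continuous T pt /\ strip_continuous T qt;
  rs_equation : forall t x, `|t| < T ->
    pt t x = q 4%N t x + nls4_component (q 0%N t x) (q 1%N t x) (q 2%N t x)
                                      (p 0%N t x) (p 1%N t x) (p 2%N t x) /\
    qt t x = - (p 4%N t x + nls4_component (p 0%N t x) (p 1%N t x) (p 2%N t x)
                                         (q 0%N t x) (q 1%N t x) (q 2%N t x)) }.

Section Conservation.
Variables (T : R) (p q : nat -> R -> R -> R) (pt qt : R -> R -> R).
Hypothesis sol : real_solution T p q pt qt.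
Local Notation p0 := (p 0%N). Local Notation p1 := (p 1%N). Local Notation p2 := (p 2%N).
Local Notation p3 := (p 3%N). Local Notation p4 := (p 4%N).
Local Notation q0 := (q 0%N). Local Notation q1 := (q 1%N). Local Notation q2 := (q 2%N).
Local Notation q3 := (q 3%N). Local Notation q4 := (q 4%N).

Let mass_density t x := p0 t x * p0 t x + q0 t x * q0 t x.

(** The time derivative of [mass_density] is the space derivative of this expression. Its
    derivatives of the solution have order at most three, the orders for which [rs_periodic] makes
    the boundary terms cancel. *)
Let mass_flux t x :=
  2 * (p0 t x * q3 t x - q0 t x * p3 t x - p1 t x * q2 t x + q1 t x * p2 t x)
  - 12 * (mass_density t x * (p0 t x * q1 t x - q0 t x * p1 t x)).

Let sol_strip : [/\ strip_continuous T p0, strip_continuous T p1,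
  strip_continuous T p2, strip_continuous T p3 & strip_continuous T p4] /\
  [/\ strip_continuous T q0, strip_continuous T q1,
  strip_continuous T q2, strip_continuous T q3 & strip_continuous T q4].
Proof.
have c j := @rs_continuous _ _ _ _ _ sol j.
have [a0 b0] := c 0%N isT; have [a1 b1] := c 1%N isT; have [a2 b2] := c 2%N isT.
by have [a3 b3] := c 3%N isT; have [a4 b4] := c 4%N isT.
Qed.

Lemma mass_conserved t : `|t| < T ->
  \oint (mass_density t) = \oint (mass_density 0).
Proof.
move=> tT.
have [[cp0 cp1 cp2 cp3 cp4] [cq0 cq1 cq2 cq3 cq4]] := sol_strip.
have [cpt cqt] := rs_time_continuous sol.
have dI (s : R) : `|s| < T -> is_derive s 1 (fun s => \oint (mass_density s)) 0.
  move=> sT; pose dm s x := 2 * (p0 s x * pt s x + q0 s x * qt s x).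
  have : is_derive s 1 (fun s => \oint (mass_density s)) (\oint (dm s)).
    apply: (is_derive_period_integral sT).
    - move=> r x rT; have [dp dq] := rs_time sol x rT.
      have /is_derive_congr := is_derive_addf (is_derive_mulf dp dp) (is_derive_mulf dq dq).
      by apply; rewrite /dm; ring.
    - by rewrite /mass_density; ctss.
    - by rewrite /dm; ctss.
  move=> /is_derive_congr; apply.
  have cs f := @strip_continuous_snd _ _ f s ^~ sT.
  refine (@period_integral_derive _ (mass_flux s) (dm s) _ _ _).
  - move=> x; have d j := @rs_derive _ _ _ _ _ sol j s x.
    have [dp0 dq0] := d 0%N isT sT; have [dp1 dq1] := d 1%N isT sT.
    have [dp2 dq2] := d 2%N isT sT; have [dp3 dq3] := d 3%N isT sT.
    have [ept eqt] := rs_equation sol x sT.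
    eapply is_derive_congr. rewrite /mass_flux /mass_density; derf. 
    rewrite /dm ept eqt /nls4_component.
    by ring.
  - by apply: cs; rewrite /dm; ctss.
  - have per j := @rs_periodic _ _ _ _ _ sol j s.
    have [e0 f0] := per 0%N isT sT; have [e1 f1] := per 1%N isT sT.
    have [e2 f2] := per 2%N isT sT; have [e3 f3] := per 3%N isT sT.
    by rewrite /mass_flux /mass_density e0 e1 e2 e3 f0 f1 f2 f3.
exact: is_derive0_strip dI tT.
Qed.

(** This is the Hamiltonian of the defocusing cubic NLS, to whose hierarchy the equation belongs.
    Both of its parts are nonnegative, so it controls the gradient. *)
Let energy t := \oint (fun x => p1 t x * p1 t x) + \oint (fun x => q1 t x * q1 t x)
  + \oint (fun x => mass_density t x * mass_density t x).

(* The flux was found by solving a linear system for the coefficients of the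
   monomials of scaling weight 7 ([u] and the space derivative have weight 1). *)
Let energy_flux t x :=
  2 * (p3 t x * q2 t x - p2 t x * q3 t x)
  + 4 * (mass_density t x * (p0 t x * q3 t x - q0 t x * p3 t x))
  + 4 * ((p1 t x * p1 t x + q1 t x * q1 t x) * (p0 t x * q1 t x - q0 t x * p1 t x))
  - 12 * (p0 t x * p0 t x * p1 t x * q2 t x)
  + 4 * (p0 t x * p0 t x * p2 t x * q1 t x)
  + 8 * (p0 t x * p1 t x * p2 t x * q0 t x)
  - 8 * (p0 t x * q0 t x * q1 t x * q2 t x)
  - 4 * (p1 t x * q0 t x * q0 t x * q2 t x)
  + 12 * (p2 t x * q0 t x * q0 t x * q1 t x)
  - 12 * (mass_density t x * mass_density t x * (p0 t x * q1 t x - q0 t x * p1 t x)).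

Lemma energy_conserved t : `|t| < T -> energy t = energy 0.
Proof.
move=> tT; apply: is_derive0_strip tT => s sT.
have [[cp0 cp1 cp2 cp3 cp4] [cq0 cq1 cq2 cq3 cq4]] := sol_strip.
have [cpt cqt] := rs_time_continuous sol.
have dp j r x jl rT := (@rs_derive _ _ _ _ _ sol j r x jl rT).1.
have dq j r x jl rT := (@rs_derive _ _ _ _ _ sol j r x jl rT).2.
have dpt (r x : R) (rT : `|r| < T) := (rs_time sol x rT).1.
have dqt (r x : R) (rT : `|r| < T) := (rs_time sol x rT).2.
have per j := @rs_periodic _ _ _ _ _ sol j.
have perp r rT := conj (per 0%N r isT rT).1 (per 1%N r isT rT).1.
have perq r rT := conj (per 0%N r isT rT).2 (per 1%N r isT rT).2.
have Dp := is_derive_gradient_energy sT dpt (fun r x => dp 0%N r x isT)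
  (fun r x => dp 1%N r x isT) perp cp0 cpt cp1 cp2.
have Dq := is_derive_gradient_energy sT dqt (fun r x => dq 0%N r x isT)
  (fun r x => dq 1%N r x isT) perq cq0 cqt cq1 cq2.
pose dm s x := 4 * (mass_density s x * (p0 s x * pt s x + q0 s x * qt s x)).
have Dm : is_derive s 1 (fun s => \oint (fun x => mass_density s x * mass_density s x))
    (\oint (dm s)).
  refine (is_derive_period_integral (vt := dm) sT _ _ _).
  - move=> r x rT.
    have d := is_derive_addf (is_derive_mulf (dpt r x rT) (dpt r x rT))
      (is_derive_mulf (dqt r x rT) (dqt r x rT)).
    have /is_derive_congr := is_derive_mulf d d.
    by apply; rewrite /dm /mass_density; ring.
  - by rewrite /mass_density; ctss.
  - by rewrite /dm /mass_density; ctss.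
have /is_derive_congr := is_derive_addf (is_derive_addf Dp Dq) Dm.
apply.
have cs f := @strip_continuous_snd _ _ f s ^~ sT.
have c1 : continuous (fun x => - 2 * (pt s x * p2 s x)).
  by apply: (cs (fun s x => - 2 * (pt s x * p2 s x))); ctss.
have c2 : continuous (fun x => - 2 * (qt s x * q2 s x)).
  by apply: (cs (fun s x => - 2 * (qt s x * q2 s x))); ctss.
have c3 : continuous (dm s) by apply: cs; rewrite /dm /mass_density; ctss.
rewrite -(period_integralD c1 c2) -(period_integralD (continuous_addf c1 c2) c3).
refine (@period_integral_derive _ (energy_flux s) _ _ _ _).
- move=> x.
  have dp0 := dp 0%N s x isT sT; have dp1 := dp 1%N s x isT sT.
  have dp2 := dp 2%N s x isT sT; have dp3 := dp 3%N s x isT sT.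
  have dq0 := dq 0%N s x isT sT; have dq1 := dq 1%N s x isT sT.
  have dq2 := dq 2%N s x isT sT; have dq3 := dq 3%N s x isT sT.
  have [ept eqt] := rs_equation sol x sT.
  eapply is_derive_congr; first by rewrite /energy_flux /mass_density; derf.
  rewrite /dm ept eqt /nls4_component /mass_density.
  by ring.
- exact: continuous_addf (continuous_addf c1 c2) c3.
- have [e0 f0] := per 0%N s isT sT; have [e1 f1] := per 1%N s isT sT.
  have [e2 f2] := per 2%N s isT sT; have [e3 f3] := per 3%N s isT sT.
  by rewrite /energy_flux /mass_density e0 e1 e2 e3 f0 f1 f2 f3.
Qed.


(** It equals [2 pi] times the real part of [exp(i (n^4 t - a))] times the [n]-th Fourier
    coefficient, hence is constant along the linear flow. With [a = 0] it sees the real part of the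
    rotated coefficient, with [a = pi / 2] the imaginary part. *)
Definition mode (n : nat) (a t : R) : R := \oint (fun x =>
  p0 t x * cos (phase n a t x) + q0 t x * sin (phase n a t x)).

Definition mode_density (n : nat) (a t x : R) : R :=
  (cubic (- n%:R) (q0 t x) (p0 t x) (q1 t x) (p1 t x)
    + 6 * (mass_density t x * mass_density t x * q0 t x)) * cos (phase n a t x)
  - (cubic n%:R (p0 t x) (q0 t x) (p1 t x) (q1 t x)
    + 6 * (mass_density t x * mass_density t x * p0 t x)) * sin (phase n a t x).

(** Real and imaginary parts of [u_xxx + ik u_xx - k^2 u_x - ik^3 u - 2 u^2 conj(u_x) - 8 |u|^2
    u_x]: the boundary terms left by moving four derivatives of the linear part, and one derivative
    of each cubic term with a second derivative, onto [exp(-ikx)]. *)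
Let flux_re k t x := p3 t x - k * q2 t x - k ^+ 2 * p1 t x + k ^+ 3 * q0 t x
  - 2 * ((p0 t x * p0 t x - q0 t x * q0 t x) * p1 t x + 2 * (p0 t x * q0 t x * q1 t x))
  - 8 * (mass_density t x * p1 t x).
Let flux_im k t x := q3 t x + k * p2 t x - k ^+ 2 * q1 t x - k ^+ 3 * p0 t x
  - 2 * (2 * (p0 t x * q0 t x * p1 t x) - (p0 t x * p0 t x - q0 t x * q0 t x) * q1 t x)
  - 8 * (mass_density t x * q1 t x).

(** The factor [n^4] produced by differentiating the phase cancels the linear term once its four
    derivatives fall on the plane wave; only nonlinear terms survive. *)
Lemma is_derive_mode (n : nat) (a t : R) : `|t| < T ->
  is_derive t 1 (mode n a) (\oint (mode_density n a t)).
Proof.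
move=> tT.
have [[cp0 cp1 cp2 cp3 cp4] [cq0 cq1 cq2 cq3 cq4]] := sol_strip.
have [cpt cqt] := rs_time_continuous sol.
have cc : strip_continuous T (fun t x => cos (phase n a t x)).
  by apply: strip_continuous_comp; [exact: continuous_cos|exact: strip_continuous_phase].
have cn : strip_continuous T (fun t x => sin (phase n a t x)).
  by apply: strip_continuous_comp; [exact: continuous_sin|exact: strip_continuous_phase].
pose dm s x := pt s x * cos (phase n a s x) + qt s x * sin (phase n a s x)
  + n%:R ^+ 4 * (p0 s x * sin (phase n a s x) - q0 s x * cos (phase n a s x)).
have cdm : strip_continuous T dm by rewrite /dm; ctss.
have dmode : is_derive t 1 (mode n a) (\oint (dm t)).
  refine (is_derive_period_integral tT _ _ cdm); last by ctss.
  move=> s x sT; have [dp dq] := rs_time sol x sT.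
  have dc := is_derive_compf (is_derive_phase_time n a s x) (is_derive_cos _).
  have ds := is_derive_compf (is_derive_phase_time n a s x) (is_derive_sin _).
  have /is_derive_congr := is_derive_addf (is_derive_mulf dp dc) (is_derive_mulf dq ds).
  by apply; rewrite /dm; ring.
have cmd : strip_continuous T (mode_density n a).
  by rewrite /mode_density /cubic /mass_density; ctss.
apply: (is_derive_congr dmode); apply/eqP; rewrite -subr_eq0.
have cs f := @strip_continuous_snd _ _ f t ^~ tT.
rewrite -(period_integralB (cs _ cdm) (cs _ cmd)); apply/eqP.
refine (@period_integral_derive _ (fun x => flux_im n%:R t x * cos (phase n a t x)
  - flux_re n%:R t x * sin (phase n a t x)) _ _ _ _).
- move=> x; have d j := @rs_derive _ _ _ _ _ sol j t x.
  have [dp0 dq0] := d 0%N isT tT; have [dp1 dq1] := d 1%N isT tT.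
  have [dp2 dq2] := d 2%N isT tT; have [dp3 dq3] := d 3%N isT tT.
  have [ept eqt] := rs_equation sol x tT.
  have dc := is_derive_compf (is_derive_phase_space n a t x) (is_derive_cos _).
  have ds := is_derive_compf (is_derive_phase_space n a t x) (is_derive_sin _).
  eapply is_derive_congr; first by rewrite /flux_re /flux_im /mass_density; derf.
  rewrite /dm ept eqt /nls4_component /mode_density /cubic /mass_density /=.
  set c := cos _; set s := sin _.
  by ring.
- by apply: continuous_subf; [exact: cs cdm|exact: cs cmd].
- have per j := @rs_periodic _ _ _ _ _ sol j t.
  have [e0 f0] := per 0%N isT tT; have [e1 f1] := per 1%N isT tT.
  have [e2 f2] := per 2%N isT tT; have [e3 f3] := per 3%N isT tT.
  rewrite /flux_re /flux_im /mass_density /phase cos_periodn sin_periodn.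
  by rewrite e0 e1 e2 e3 f0 f1 f2 f3 mulr0 add0r.
Qed.

End Conservation.
End RealForm.

(** * Bounds on the cubic terms *)

Section CubicBounds.
Context {R : realType}.

(** In [cubic] the absolute values of the coefficients add up to 24 over the monomials without [k],
    and to 24 again over those with the factor [k]. *)
Lemma cubic_diff (k K D a b a1 b1 c d c1 d1 : R) : `|k| <= K ->
  `|a1 * a1 * a - c1 * c1 * c| <= D -> `|b1 * b1 * a - d1 * d1 * c| <= D ->
  `|a1 * b1 * b - c1 * d1 * d| <= D -> `|a * b * a1 - c * d * c1| <= D ->
  `|a * a * b1 - c * c * d1| <= D -> `|b * b * b1 - d * d * d1| <= D ->
  `|cubic k a b a1 b1 - cubic k c d c1 d1| <= 24 * (1 + K) * D.
Proof.
move=> kK m1 m2 m3 m4 m5 m6; rewrite /cubic.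
have km (m : R) : `|m| <= D -> `|k * m| <= K * D by move=> mD; rewrite normrM ler_pM.
move: (km _ m4) (km _ m5) (km _ m6) m1 m2 m3; rewrite !ler_norml.
by move=> /andP[? ?] /andP[? ?] /andP[? ?] /andP[? ?] /andP[? ?] /andP[? ?];
  apply/andP; split; lra.
Qed.

Lemma cubic_le (k K D a b a1 b1 : R) : `|k| <= K ->
  `|a1 * a1 * a| <= D -> `|b1 * b1 * a| <= D -> `|a1 * b1 * b| <= D ->
  `|a * b * a1| <= D -> `|a * a * b1| <= D -> `|b * b * b1| <= D ->
  `|cubic k a b a1 b1| <= 24 * (1 + K) * D.
Proof.
move=> kK; have := @cubic_diff k K D a b a1 b1 0 0 0 0 kK.
by rewrite {2}/cubic !(mulr0, subr0, addr0).
Qed.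

Lemma norm_mul_le_sqr (x y S : R) : x * x <= S -> y * y <= S -> `|x * y| <= S.
Proof.
move=> xS yS; have := sqr_ge0 (x + y); have := sqr_ge0 (x - y).
by rewrite !expr2 ler_norml => ? ?; apply/andP; split; lra.
Qed.

(** Each monomial has an undifferentiated factor, bounded by [e]; the product of the two others is
    bounded by the [H^1] density. *)
Lemma cubic_energy_le (k K e S a b a1 b1 : R) : `|k| <= K -> `|a| <= e ->
  `|b| <= e -> a * a + b * b + (a1 * a1 + b1 * b1) <= S ->
  `|cubic k a b a1 b1| <= 24 * (1 + K) * (e * S).
Proof.
move=> kK ae be abS.
have sq (x : R) : 0 <= x * x by rewrite -expr2 sqr_ge0.
have [[aS bS] [a1S b1S]] : (a * a <= S /\ b * b <= S) /\ (a1 * a1 <= S /\ b1 * b1 <= S).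
  by have := sq a; have := sq b; have := sq a1; have := sq b1; lra.
have m (x y z : R) : `|x| <= e -> y * y <= S -> z * z <= S -> `|x * (y * z)| <= e * S.
  by move=> xe yS zS; rewrite normrM ler_pM// norm_mul_le_sqr.
apply: cubic_le => //; first [by rewrite mulrC m | by rewrite -mulrA m].
Qed.

(** Primed letters belong to the wave. The factors [y], [z] of the solution may be derivatives,
    which have no pointwise bound, so their product is expanded about [y' z']: the quadratic
    remainder is absorbed by [W], and a term linear in a difference [w] by
    [e^2 |w| <= (e^4 + w^2) / 2]. The two halves balance since [W] will integrate to [O(e^4)]. *)
Lemma monomial_diff (A B e W x y z x' y' z' : R) : 0 <= A -> 0 <= B ->
  0 <= e <= 1 -> `|x| <= A * e -> `|x'| <= B * e -> `|y'| <= B * e ->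
  `|z'| <= B * e -> (x - x') * (x - x') <= W -> (y - y') * (y - y') <= W ->
  (z - z') * (z - z') <= W ->
  `|x * (y * z) - x' * (y' * z')| <= (A + A * B + B * B) * (e ^+ 4 + W).
Proof.
move=> A0 B0 /andP[e0 e1] xA x'B y'B z'B dx dy dz.
have W0 : 0 <= W by rewrite (le_trans _ dx)// -expr2 sqr_ge0.
have amgm (w : R) : w * w <= W -> e ^+ 2 * `|w| <= (e ^+ 4 + W) / 2.
  move=> wW; have := sqr_ge0 (e ^+ 2 - `|w|).
  have : `|w| * `|w| <= W by rewrite -normrM ger0_norm// -expr2 sqr_ge0.
  by rewrite expr2; lra.
have E0 : 0 <= e ^+ 4 by rewrite exprn_ge0.
have -> : x * (y * z) - x' * (y' * z') = x * ((y - y') * (z - z')) +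
    (x * (y - y') * z' + x * y' * (z - z')) + (x - x') * y' * z' by ring.
have t1 : `|x * ((y - y') * (z - z'))| <= A * W.
  rewrite normrM ler_pM//; first by rewrite (le_trans xA)// ler_piMr.
  exact: norm_mul_le_sqr.
have t2 : `|x * (y - y') * z'| <= A * B * ((e ^+ 4 + W) / 2).
  rewrite !normrM (le_trans (ler_pM _ _ (ler_wpM2r (normr_ge0 _) xA) z'B))// ?mulr_ge0//.
  rewrite (_ : A * e * `|y - y'| * (B * e) = A * B * (e ^+ 2 * `|y - y'|)); last by ring.
  by rewrite ler_wpM2l ?mulr_ge0// amgm.
have t3 : `|x * y' * (z - z')| <= A * B * ((e ^+ 4 + W) / 2).
  rewrite !normrM (le_trans (ler_wpM2r (normr_ge0 _) (ler_pM _ _ xA y'B)))//.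
  rewrite (_ : A * e * (B * e) * `|z - z'| = A * B * (e ^+ 2 * `|z - z'|)); last by ring.
  by rewrite ler_wpM2l ?mulr_ge0// amgm.
have t4 : `|(x - x') * y' * z'| <= B * B * ((e ^+ 4 + W) / 2).
  rewrite -mulrA mulrC !normrM (le_trans (ler_wpM2r (normr_ge0 _) (ler_pM _ _ y'B z'B)))//.
  rewrite (_ : B * e * (B * e) * `|x - x'| = B * B * (e ^+ 2 * `|x - x'|)); last by ring.
  by rewrite ler_wpM2l ?mulr_ge0// amgm.
have H1 : 0 <= A * e ^+ 4 by rewrite mulr_ge0.
have H2 : 0 <= B * B * (e ^+ 4 + W) by rewrite !mulr_ge0// addr_ge0.
rewrite (le_trans (ler_normD _ _))// (le_trans (lerD (ler_normD _ _) t4))//.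
rewrite (le_trans (lerD (lerD t1 (ler_normD _ _)) (lexx _)))//.
lra.
Qed.

Lemma cubic_perturbation (k K A B e W a b a1 b1 c d c1 d1 : R) : `|k| <= K ->
  0 <= A -> 0 <= B -> 0 <= e <= 1 -> `|a| <= A * e -> `|b| <= A * e ->
  `|c| <= B * e -> `|d| <= B * e -> `|c1| <= B * e -> `|d1| <= B * e ->
  (a - c) * (a - c) + (b - d) * (b - d) +
    ((a1 - c1) * (a1 - c1) + (b1 - d1) * (b1 - d1)) <= W ->
  `|cubic k a b a1 b1 - cubic k c d c1 d1| <=
    24 * (1 + K) * ((A + A * B + B * B) * (e ^+ 4 + W)).
Proof.
move=> kK A0 B0 e01 aA bA cB dB c1B d1B HW.
have sq (x : R) : 0 <= x * x by rewrite -expr2 sqr_ge0.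
have [[aW bW] [a1W b1W]] : ((a - c) * (a - c) <= W /\ (b - d) * (b - d) <= W) /\
    ((a1 - c1) * (a1 - c1) <= W /\ (b1 - d1) * (b1 - d1) <= W).
  have := sq (a - c); have := sq (b - d); have := sq (a1 - c1); have := sq (b1 - d1).
  lra.
have m x y z x' y' z' := @monomial_diff A B e W x y z x' y' z' A0 B0 e01.
apply: cubic_diff => //; first
  [by rewrite (mulrC _ a) (mulrC _ c) m | by rewrite (mulrC _ b) (mulrC _ d) m
  |by rewrite -!mulrA m].
Qed.

End CubicBounds.

(** * Linear waves *)

Section Wave.
Context {R : realType}.
Variables (n : nat) (b e : R).
Implicit Types a t x : R.
Hypothesis n_gt0 : (0 < n)%N.
Local Notation "'\oint' f" := (period_integral f) (at level 10, f at next level).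
Local Notation N := (n%:R : R).

Lemma continuous_phase_cos a t : continuous (fun x : R => cos (phase n a t x)).
Proof.
move=> x; apply: (is_derive_continuous (is_derive_compf _ (is_derive_cos _))).
Qed.

Lemma continuous_phase_sin a t : continuous (fun x : R => sin (phase n a t x)).
Proof.
move=> x; apply: (is_derive_continuous (is_derive_compf _ (is_derive_sin _))).
Qed.

Lemma integral_phase_cos a t : \oint (fun x : R => cos (phase n a t x)) = 0.
Proof.
refine (@period_integral_derive _ (fun x => N^-1 * sin (phase n a t x)) _ _ _ _).
- move=> x; have ds := is_derive_compf (is_derive_phase_space n a t x) (is_derive_sin _).
  have /is_derive_congr := is_derive_mulf (is_derive_cstf N^-1 x) ds.
  apply; rewrite /= mulr0 addr0 mulrCA mulVf ?mulr1//.
  by rewrite pnatr_eq0 -lt0n.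
- exact: continuous_phase_cos.
- by rewrite /phase sin_periodn mulr0 add0r.
Qed.

Lemma integral_phase_sin a t : \oint (fun x : R => sin (phase n a t x)) = 0.
Proof.
refine (@period_integral_derive _ (fun x => - N^-1 * cos (phase n a t x)) _ _ _ _).
- move=> x; have ds := is_derive_compf (is_derive_phase_space n a t x) (is_derive_cos _).
  have /is_derive_congr := is_derive_mulf (is_derive_cstf (- N^-1) x) ds.
  apply; rewrite /= mulr0 addr0 mulNr mulNr mulrN opprK mulrCA mulVf ?mulr1//.
  by rewrite pnatr_eq0 -lt0n.
- exact: continuous_phase_sin.
- by rewrite /phase cos_periodn mulr0 add0r.
Qed.

Definition wave_re t x : R := e * (1 + b * cos (phase n 0 t x)).
Definition wave_im t x : R := e * (b * sin (phase n 0 t x)).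
Definition wave_re1 t x : R := - (N * (e * (b * sin (phase n 0 t x)))).
Definition wave_im1 t x : R := N * (e * (b * cos (phase n 0 t x))).

Lemma is_derive_wave_re t x : is_derive x 1 (wave_re t) (wave_re1 t x).
Proof.
have dc := is_derive_compf (is_derive_phase_space n 0 t x) (is_derive_cos _).
have /is_derive_congr := is_derive_mulf (is_derive_cstf e x)
  (is_derive_addf (is_derive_cstf 1 x) (is_derive_mulf (is_derive_cstf b x) dc)).
by apply; rewrite /wave_re1; ring.
Qed.

Lemma is_derive_wave_im t x : is_derive x 1 (wave_im t) (wave_im1 t x).
Proof.
have ds := is_derive_compf (is_derive_phase_space n 0 t x) (is_derive_sin _).
have /is_derive_congr := is_derive_mulf (is_derive_cstf e x)
  (is_derive_mulf (is_derive_cstf b x) ds).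
by apply; rewrite /wave_im1; ring.
Qed.

(** The cubic part of [mode_density] at the linear wave, for [a = pi / 2]. The quintic part is
    [O(e^5)] and is left to the error. *)
Definition wave_density t x : R :=
  cubic (- N) (wave_im t x) (wave_re t x) (wave_im1 t x) (wave_re1 t x)
    * cos (phase n (pi / 2) t x)
  - cubic N (wave_re t x) (wave_im t x) (wave_re1 t x) (wave_im1 t x)
    * sin (phase n (pi / 2) t x).

Lemma phase_pihalf t x :
  cos (phase n (pi / 2) t x) = - sin (phase n 0 t x) /\
  sin (phase n (pi / 2) t x) = cos (phase n 0 t x) :> R.
Proof.
have -> : phase n (pi / 2) t x = phase n 0 t x + pi / 2 by rewrite /phase; ring.
by rewrite cosD sinD cos_pihalf sin_pihalf !mulr0 !mulr1 !add0r.
Qed.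

Definition resonance : R := 8 * (N * N * b) + 12 * (N * N * b * b * b).

(** With frequencies [0] and [n] only, every cubic interaction that lands on mode [n] is resonant;
    hence the value does not depend on [t] and no averaging in time is needed. *)
Lemma integral_wave_density t :
  \oint (wave_density t) = - (2 * pi * (e ^+ 3 * resonance)).
Proof.
pose c x := cos (phase n 0 t x); pose s x := sin (phase n 0 t x).
have cc : continuous c by exact: continuous_phase_cos.
have cs : continuous s by exact: continuous_phase_sin.
(* The part of the density oscillating in space at the frequencies [n] and [2 n]; it has zero
   mean. *)
pose osc x := - (e ^+ 3 * (18 * (N * N * b * b) * c x
  - 2 * (N * N * b) * (c x * c x - s x * s x))).
have cosc : continuous osc by rewrite /osc; ctsf.
have -> : \oint (wave_density t) = \oint (fun x => - (e ^+ 3 * resonance) + osc x).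
  apply: eq_period_integral => x; rewrite /wave_density.
  have [-> ->] := phase_pihalf t x.
  rewrite /wave_re /wave_im /wave_re1 /wave_im1 /osc -/(c x) -/(s x) /cubic /resonance.
  have cs1 : c x * c x + s x * s x - 1 = 0 by rewrite -!expr2 cos2Dsin2 subrr.
  (* The two sides agree only modulo [c^2 + s^2 = 1]; the factor of [0] is the cofactor of
     [c^2 + s^2 - 1] in their difference. *)
  rewrite -[RHS](addr0 _) -(mulr0 (- (e ^+ 3 * (N * N * b) *
    (12 * b * b * (c x * c x) + 12 * b * b * (s x * s x) + 18 * b * c x + 8 + 12 * b * b)))).
  by rewrite -cs1; ring.
rewrite period_integralD ?period_integral_cst; [|exact: continuous_cstf|exact: cosc].
rewrite (_ : \oint osc = 0); first by ring.
refine (@period_integral_derive _ (fun x => - (e ^+ 3 * (18 * (N * b * b) * s x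
  - 2 * (N * b) * (s x * c x)))) _ _ cosc _).
- move=> x.
  have dc := is_derive_compf (is_derive_phase_space n 0 t x) (is_derive_cos _).
  have ds := is_derive_compf (is_derive_phase_space n 0 t x) (is_derive_sin _).
  eapply is_derive_congr; first by rewrite /s /c; derf.
  by rewrite /osc /c /s /=; ring.
- by rewrite /s /c /phase sin_periodn cos_periodn mulr0 add0r.
Qed.

Lemma integral_wave_mass t :
  \oint (fun x => wave_re t x * wave_re t x + wave_im t x * wave_im t x)
  = 2 * pi * (e * e * (1 + b * b)).
Proof.
rewrite -[RHS]addr0 -(mulr0 (2 * (e * e * b))) -(integral_phase_cos 0 t).
rewrite -period_integralZ; last exact: continuous_phase_cos.
rewrite [2 * pi * _]mulrC -period_integral_cst -period_integralD.
- apply: eq_period_integral => x; rewrite /wave_re /wave_im.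
  have := cos2Dsin2 (phase n 0 t x); rewrite !expr2 => cs1.
  rewrite (_ : e * e * (1 + b * b) = e * e * (1 + b * b *
    (cos (phase n 0 t x) * cos (phase n 0 t x) + sin (phase n 0 t x) * sin (phase n 0 t x)))).
    by ring.
  by rewrite cs1 mulr1.
- exact: continuous_cstf.
- by apply: continuous_mulf; [exact: continuous_cstf|exact: continuous_phase_cos].
Qed.

Lemma integral_wave_gradient t :
  \oint (fun x => wave_re1 t x * wave_re1 t x + wave_im1 t x * wave_im1 t x)
  = 2 * pi * (N * N * (e * e * (b * b))).
Proof.
rewrite [RHS]mulrC -period_integral_cst.
apply: eq_period_integral => x; rewrite /wave_re1 /wave_im1.
have := cos2Dsin2 (phase n 0 t x); rewrite !expr2 => cs1.
rewrite -[RHS]mulr1 -cs1; ring.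
Qed.

End Wave.

(** * Small solutions *)

Section SmallSolution.
Context {R : realType}.
Variables (n : nat) (b e T : R) (p q : nat -> R -> R -> R) (pt qt : R -> R -> R).
Hypotheses (n_gt0 : (0 < n)%N) (b_ge0 : 0 <= b) (e01 : 0 <= e <= 1).
Hypotheses (T_gt0 : 0 < T) (sol : real_solution T p q pt qt).
Hypothesis init : forall x, p 0%N 0 x = wave_re n b e 0 x /\
                            q 0%N 0 x = wave_im n b e 0 x.
Implicit Types a t x : R.
Local Notation "'\oint' f" := (period_integral f) (at level 10, f at next level).
Local Notation N := (n%:R : R).
Local Notation p0 := (p 0%N). Local Notation p1 := (p 1%N).
Local Notation q0 := (q 0%N). Local Notation q1 := (q 1%N).

Let mass t := \oint (fun x => p0 t x * p0 t x + q0 t x * q0 t x).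
Let grad t := \oint (fun x => p1 t x * p1 t x + q1 t x * q1 t x).

Let sqr_pos x : 0 <= x * x.
Proof. by rewrite -expr2 sqr_ge0. Qed.

Let zero_strip : `|0 : R| < T.
Proof. by rewrite normr0. Qed.

Let space_continuous t : `|t| < T ->
  [/\ continuous (p0 t), continuous (q0 t), continuous (p1 t) & continuous (q1 t)].
Proof.
move=> tT; have [cp0 cq0] := @rs_continuous _ _ _ _ _ _ sol 0%N isT.
have [cp1 cq1] := @rs_continuous _ _ _ _ _ _ sol 1%N isT.
by split; [exact: strip_continuous_snd cp0 tT|exact: strip_continuous_snd cq0 tT|
  exact: strip_continuous_snd cp1 tT|exact: strip_continuous_snd cq1 tT].
Qed.

Let init1 x : p1 0 x = wave_re1 n b e 0 x /\ q1 0 x = wave_im1 n b e 0 x.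
Proof.
have [dp dq] := @rs_derive _ _ _ _ _ _ sol 0%N 0 x isT zero_strip.
have Ep : p0 0 = wave_re n b e 0 by apply/funext => y; case: (init y).
have Eq : q0 0 = wave_im n b e 0 by apply/funext => y; case: (init y).
split.
- have := is_derive_wave_re n b e 0 x; rewrite -Ep => d.
  by rewrite -(@derive_val _ _ _ _ _ _ _ dp) (@derive_val _ _ _ _ _ _ _ d).
- have := is_derive_wave_im n b e 0 x; rewrite -Eq => d.
  by rewrite -(@derive_val _ _ _ _ _ _ _ dq) (@derive_val _ _ _ _ _ _ _ d).
Qed.

(** * A priori bounds in [H^1] and in the sup norm *)

Lemma massE t : `|t| < T -> mass t = 2 * pi * (e * e * (1 + b * b)).
Proof.
move=> tT; rewrite /mass (mass_conserved sol tT) -(integral_wave_mass b e n_gt0 0).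
by apply: eq_period_integral => x; have [-> ->] := init x.
Qed.

(** The quartic energy at time [t] is dropped and the initial one is estimated by
    [|u_0| <= (1 + b) e]. The first summand is exactly the gradient energy of the linear wave, so
    the excess is [O(e^4)]; this precision is what [wave_distance_le] needs. *)
Lemma grad_le t : `|t| < T ->
  grad t <= 2 * pi * (N * N * (e * e * (b * b))) + 2 * pi * (1 + b) ^+ 4 * e ^+ 4.
Proof.
move=> tT; have [cp0 cq0 cp1 cq1] := space_continuous tT.
have [cp00 cq00 cp10 cq10] := space_continuous zero_strip.
rewrite /grad period_integralD; [|by ctsf..].
have := energy_conserved sol tT.
rewrite -[X in _ = X + _ -> _]period_integralD; [|by ctsf..].
rewrite (_ : \oint (fun x => p1 0 x * p1 0 x + q1 0 x * q1 0 x) =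
  2 * pi * (N * N * (e * e * (b * b)))); last first.
  rewrite -(integral_wave_gradient n b e 0).
  by apply: eq_period_integral => x; have [-> ->] := init1 x.
set m := fun s x => (p0 s x * p0 s x + q0 s x * q0 s x)
  * (p0 s x * p0 s x + q0 s x * q0 s x).
have mt : 0 <= \oint (m t) by apply: period_integral_ge0 => x; exact: sqr_pos.
suff m0 : \oint (m 0) <= 2 * pi * (1 + b) ^+ 4 * e ^+ 4 by lra.
have -> : 2 * pi * (1 + b) ^+ 4 * e ^+ 4 = \oint (fun=> (1 + b) ^+ 4 * e ^+ 4).
  by rewrite period_integral_cst; ring.
apply: le_period_integral; [by rewrite /m; ctsf|exact: continuous_cstf|move=> x _].
have r4 : p0 0 x * p0 0 x + q0 0 x * q0 0 x <= (1 + b) ^+ 2 * e ^+ 2.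
  have [-> ->] := init x; rewrite /wave_re /wave_im.
  have := cos2Dsin2 (phase n 0 0 x); have := cos_le1 (phase n 0 0 x).
  set c := cos _; set s := sin _; rewrite !expr2 => c1 cs1.
  rewrite (_ : _ + _ = (1 + 2 * (b * c) + b * b * (c * c + s * s)) * (e * e)); last by ring.
  rewrite cs1 ler_wpM2r//; have : b * c <= b by rewrite ler_piMr.
  lra.
have r0 : 0 <= p0 0 x * p0 0 x + q0 0 x * q0 0 x by rewrite addr_ge0.
rewrite /m (le_trans (ler_pM r0 r0 r4 r4))// le_eqVlt; apply/orP; left.
by apply/eqP; ring.
Qed.

Definition h1_bound : R :=
  2 * pi * (1 + b * b) + 2 * pi * (N * N * (b * b)) + 2 * pi * (1 + b) ^+ 4.

Let quartic_ge0 : 0 <= 2 * pi * (1 + b) ^+ 4.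
Proof. by rewrite mulr_ge0 ?exprn_ge0 ?addr_ge0// ltW// twopi_gt0. Qed.

Lemma h1_le t : `|t| < T -> mass t + grad t <= h1_bound * e ^+ 2.
Proof.
move=> tT; have := grad_le tT; rewrite (massE tT) /h1_bound; case/andP: e01 => e0 e1.
have e4 : e ^+ 4 <= e ^+ 2 by rewrite (_ : e ^+ 4 = e ^+ 2 * e ^+ 2)
  ?ler_piMr ?sqr_ge0 ?exprn_ile1// -exprD.
have := ler_wpM2l quartic_ge0 e4; set E4 := e ^+ 4; rewrite !expr2; lra.
Qed.

(** This is [1 + y], where [y = 1 + b^2 + h1_bound] is the constant that [sobolev_sup] gives for the
    square; [y <= (1 + y)^2] avoids a square root. *)
Definition sup_bound : R := 2 + b * b + h1_bound.

Lemma h1_bound_gt0 : 0 < h1_bound.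
Proof.
have pi0 := @pi_gt0 R; have b2 := sqr_pos b.
have : 0 <= pi * (b * b) by rewrite mulr_ge0// ltW.
have : 0 <= pi * (N * N * (b * b)) by rewrite !mulr_ge0// ltW.
have := quartic_ge0; rewrite /h1_bound; lra.
Qed.

Lemma sup_bound_gt0 : 0 < sup_bound.
Proof. by have := h1_bound_gt0; have := sqr_pos b; rewrite /sup_bound; lra. Qed.

Lemma sup_le t x : `|t| < T -> 0 <= x <= 2 * pi ->
  `|p0 t x| <= sup_bound * e /\ `|q0 t x| <= sup_bound * e.
Proof.
move=> tT x01; have [cp0 cq0 cp1 cq1] := space_continuous tT.
have d y := @rs_derive _ _ _ _ _ _ sol 0%N t y isT tT.
have := h1_le tT; rewrite (massE tT).
have := massE tT; rewrite /mass /grad !period_integralD; try by ctsf.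
have := @sobolev_sup R (p0 t) (p1 t) x (fun y => (d y).1) cp1 x01.
have := @sobolev_sup R (q0 t) (q1 t) x (fun y => (d y).2) cq1 x01.
rewrite !period_integralD; try by ctsf.
have I f : 0 <= \oint (fun x => f x * f x) by apply: period_integral_ge0 => y; exact: sqr_pos.
move: (I (p0 t)) (I (q0 t)) (I (p1 t)) (I (q1 t)).
set I1 := \oint _; set I2 := \oint _; set I3 := \oint _; set I4 := \oint _.
move=> I1p I2p I3p I4p Hq Hp HM HH.
have pi0 := @pi_gt0 R; have S0 := h1_bound_gt0.
have e20 : 0 <= e ^+ 2 by exact: sqr_ge0.
have b2 := sqr_pos b.
have HM2 : I1 + I2 <= (1 + b * b) * e ^+ 2 * (2 * pi) by rewrite HM; lra.
have pS : I1 + I3 + (I2 + I4) <= h1_bound * e ^+ 2 by rewrite -HM in HH; lra.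
have bound z J : z * z * (2 * pi) <= J ->
    J <= (1 + b * b) * e ^+ 2 * (2 * pi) + h1_bound * e ^+ 2 * (2 * pi) ->
    `|z| <= sup_bound * e.
  move=> zJ J4; have zz : z * z <= (1 + b * b + h1_bound) * e ^+ 2.
    by rewrite -(ler_pM2r (@twopi_gt0 R)); lra.
  rewrite -ler_sqr ?nnegrE ?normr_ge0//; last first.
    by rewrite mulr_ge0// ?(ltW sup_bound_gt0)//; case/andP: e01.
  rewrite -normrX ger0_norm ?sqr_ge0// expr2 (le_trans zz)// exprMn ler_wpM2r//.
  set y := 1 + b * b + h1_bound; have -> : sup_bound = 1 + y by rewrite /sup_bound /y; ring.
  have := sqr_pos y; have : 0 <= y by rewrite /y; lra.
  by rewrite expr2; lra.
split; [apply: bound Hp _|apply: bound Hq _].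
- rewrite lerD//; first by lra.
  by rewrite (ler_wpM2r (ltW (@twopi_gt0 R)))//; lra.
- rewrite lerD//; first by lra.
  by rewrite (ler_wpM2r (ltW (@twopi_gt0 R)))//; lra.
Qed.

(** * Slow drift of the modes *)

Definition drift_bound : R :=
  2 * (24 * (1 + N) + 12 * sup_bound ^+ 2) * sup_bound * h1_bound.

Lemma drift_bound_ge0 : 0 <= drift_bound.
Proof.
have S0 := h1_bound_gt0; have N0 : 0 <= N by [].
have A2 : 0 <= sup_bound ^+ 2 by exact: sqr_ge0.
by rewrite /drift_bound !mulr_ge0 ?(ltW S0)//; [lra|exact: ltW sup_bound_gt0].
Qed.

(** The power [e^3] is a sup factor [e] times an energy [e^2]. In the quintic term one factor
    [|u|^2] plays the energy and the other is bounded using [e <= 1]. *)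
Lemma mode_density_integral_le (k : nat) a t : (k <= n)%N -> `|t| < T ->
  `|\oint (mode_density p q k a t)| <= drift_bound * e ^+ 3.
Proof.
move=> kn tT; have [cp0 cq0 cp1 cq1] := space_continuous tT.
have S0 := h1_bound_gt0; have e0 : 0 <= e by case/andP: e01.
set A := sup_bound; have A0 : 0 <= A by exact: ltW sup_bound_gt0.
have N0 : 0 <= N by [].
set K := 2 * (24 * (1 + N) + 12 * A ^+ 2) * A * e.
have K0 : 0 <= K.
  have A2 : 0 <= A ^+ 2 by exact: sqr_ge0.
  by rewrite /K !mulr_ge0//; lra.
pose S x := p0 t x * p0 t x + q0 t x * q0 t x + (p1 t x * p1 t x + q1 t x * q1 t x).
have cS : continuous S by rewrite /S; ctsf.
have cc := @continuous_phase_cos R k a t.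
have cs := @continuous_phase_sin R k a t.
apply: (@le_trans _ _ (\oint (fun x => K * S x))).
  apply: le_norm_period_integral; [by rewrite /mode_density /cubic; ctsf|by ctsf|].
  move=> x x01; have [pA qA] := sup_le tT x01.
  have kN : `|k%:R : R| <= N by rewrite normr_nat ler_nat.
  have SE : p0 t x * p0 t x + q0 t x * q0 t x + (p1 t x * p1 t x + q1 t x * q1 t x) <= S x by [].
  have z1 := cubic_energy_le kN pA qA SE.
  have SE' : q0 t x * q0 t x + p0 t x * p0 t x + (q1 t x * q1 t x + p1 t x * p1 t x) <= S x.
    by rewrite /S; lra.
  have kN' : `|- k%:R : R| <= N by rewrite normrN.
  have z2 := cubic_energy_le kN' qA pA SE'.
  pose r := p0 t x * p0 t x + q0 t x * q0 t x.
  have r_ge0 : 0 <= r by rewrite addr_ge0.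
  have rS : r <= S x by rewrite lerDl addr_ge0.
  have AA z : `|z| <= A * e -> z * z <= A ^+ 2.
    move=> zA; rewrite -expr2 -real_normK ?num_real// ler_sqr ?nnegrE//.
    by rewrite (le_trans zA)// ler_piMr//; case/andP: e01.
  have r2 : r <= 2 * A ^+ 2 by have := AA _ pA; have := AA _ qA; rewrite /r; lra.
  have quint z : `|z| <= A * e -> `|6 * (r * r * z)| <= 12 * A ^+ 2 * (A * e * S x).
    move=> zA; rewrite !normrM (ger0_norm r_ge0) [`|6|]ger0_norm//.
    have h := ler_pM (mulr_ge0 r_ge0 r_ge0) (normr_ge0 z)
      (ler_pM r_ge0 r_ge0 r2 rS) zA.
    by rewrite (_ : _ * (A * e * S x) = 6 * (2 * A ^+ 2 * S x * (A * e))) ?ler_wpM2l//; ring.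
  rewrite /mode_density -/r.
  have cos1 := cos_max (phase k a t x); have sin1 := sin_max (phase k a t x).
  have total u v w (z c : R) : `|u| <= v -> `|z| <= w -> `|c| <= 1 -> `|(u + z) * c| <= v + w.
    move=> uv zw c1; rewrite normrM -[leRHS]mulr1 ler_pM//.
    by rewrite (le_trans (ler_normD _ _))// lerD.
  rewrite (le_trans (ler_normB _ _))//.
  rewrite (le_trans (lerD (total _ _ _ _ _ z2 (quint _ qA) cos1)
                          (total _ _ _ _ _ z1 (quint _ pA) sin1)))//.
  by rewrite /K le_eqVlt; apply/orP; left; apply/eqP; rewrite -/A; ring.
rewrite period_integralZ// {1}/S period_integralD; [|by ctsf..].
rewrite (le_trans (ler_wpM2l K0 (h1_le tT)))// /K /drift_bound -/A.
by rewrite le_eqVlt; apply/orP; left; apply/eqP; ring.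
Qed.

Lemma mode_drift (k : nat) a t : (k <= n)%N -> `|t| < T ->
  `|mode p q k a t - mode p q k a 0| <= drift_bound * T * e ^+ 3.
Proof.
move=> kn tT; have S0 := h1_bound_gt0; have e0 : 0 <= e by case/andP: e01.
have := @mean_value_bound R _ _ T 0 (drift_bound * e ^+ 3) t
  (fun s sT => is_derive_mode sol k a sT).
rewrite mul0r subr0 => /(_ _ tT) H; apply: (le_trans (H _)).
  by move=> s sT; rewrite subr0 mode_density_integral_le.
by rewrite mulrAC (ler_wpM2r (exprn_ge0 _ e0))// (ler_wpM2l drift_bound_ge0)// ltW.
Qed.

Let mode0E t : mode p q 0 0 t = \oint (p0 t).
Proof.
apply: eq_period_integral => x.
by rewrite /phase mul0r expr0n/= oppr0 mul0r !addr0 cos0 sin0 mulr1 mulr0 addr0.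
Qed.

(** The third value vanishes because [e b] is real: the resonant growth is observed against a zero
    background. *)
Lemma initial_mode : [/\ mode p q 0 0 0 = 2 * pi * e,
  mode p q n 0 0 = 2 * pi * (e * b) & mode p q n (pi / 2) 0 = 0].
Proof.
have cc : continuous (fun x : R => cos (phase n 0 0 x)) by exact: continuous_phase_cos.
have cs : continuous (fun x : R => sin (phase n 0 0 x)) by exact: continuous_phase_sin.
have ccst (d : R) : continuous (fun _ : R => d) by exact: continuous_cstf.
have cmul (d : R) (f : R -> R) : continuous f -> continuous (fun x : R => d * f x).
  by move=> cf; exact: continuous_mulf (ccst d) cf.
have ic := @integral_phase_cos R n n_gt0 0 0.
have isn := @integral_phase_sin R n n_gt0 0 0.
split.
- rewrite mode0E (_ : \oint (p0 0) = \oint (fun x => e + e * b * cos (phase n 0 0 x))).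
    rewrite period_integralD ?period_integral_cst ?period_integralZ ?ic//; last exact: cmul.
    by ring.
  by apply: eq_period_integral => x; have [-> _] := init x; rewrite /wave_re; ring.
- rewrite (_ : mode _ _ _ _ _ = \oint (fun x => e * b + e * cos (phase n 0 0 x))).
    rewrite period_integralD ?period_integral_cst ?period_integralZ ?ic//; last exact: cmul.
    by ring.
  apply: eq_period_integral => x; have [-> ->] := init x; rewrite /wave_re /wave_im.
  have := cos2Dsin2 (phase n 0 0 x); rewrite !expr2 => cs1.
  by rewrite -[e * b]mulr1 -[X in _ = _ * X + _]cs1; ring.
- rewrite (_ : mode _ _ _ _ _ = \oint (fun x => - e * sin (phase n 0 0 x))).
    by rewrite period_integralZ// isn mulr0.
  apply: eq_period_integral => x; have [-> ->] := init x; rewrite /wave_re /wave_im.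
  by have [-> ->] := phase_pihalf n 0 x; ring.
Qed.

(** * Distance to the linear wave in [H^1] *)

Definition wave_distance t x : R :=
  (p0 t x - wave_re n b e t x) * (p0 t x - wave_re n b e t x)
  + (q0 t x - wave_im n b e t x) * (q0 t x - wave_im n b e t x)
  + ((p1 t x - wave_re1 n b e t x) * (p1 t x - wave_re1 n b e t x)
    + (q1 t x - wave_im1 n b e t x) * (q1 t x - wave_im1 n b e t x)).

(** The outer summands are the drift of the modes [0] and [n] times their coefficients in the
    expanded square, for the function and for its gradient; the middle one is the excess allowed by
    [grad_le]. *)
Definition distance_bound : R :=
  2 * (1 + b) * (drift_bound * T) + 2 * pi * (1 + b) ^+ 4
  + 2 * (N * N * b) * (drift_bound * T).

Let wave_continuous t : [/\ continuous (wave_re n b e t), continuous (wave_im n b e t),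
  continuous (wave_re1 n b e t) & continuous (wave_im1 n b e t)].
Proof.
have cc : continuous (fun x : R => cos (phase n 0 t x)) by exact: continuous_phase_cos.
have cs : continuous (fun x : R => sin (phase n 0 t x)) by exact: continuous_phase_sin.
by split; rewrite /wave_re /wave_im /wave_re1 /wave_im1; ctsf.
Qed.

(* The inner products of the solution with the linear wave are combinations of
   its modes [0] and [n], which drift by [O(e ^ 3)]; the norms are conserved up
   to [O(e ^ 4)]. *)
Lemma wave_distance_le t : `|t| < T ->
  \oint (wave_distance t) <= distance_bound * e ^+ 4.
Proof.
move=> tT; have [cp0 cq0 cp1 cq1] := space_continuous tT.
have [cP cQ cP1 cQ1] := wave_continuous t.
have cc : continuous (fun x : R => cos (phase n 0 t x)) by exact: continuous_phase_cos.
have cs : continuous (fun x : R => sin (phase n 0 t x)) by exact: continuous_phase_sin.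
have e0 : 0 <= e by case/andP: e01.
(* Integration by parts puts a second derivative on the wave, where it multiplies the oscillating
   part by [- n^2] and kills the constant. *)
have grad_mode : \oint (fun x => p1 t x * wave_re1 n b e t x + q1 t x * wave_im1 n b e t x)
    = N * N * (e * b) * mode p q n 0 t.
  rewrite /mode -period_integralZ; last by ctsf.
  apply/eqP; rewrite -subr_eq0 -period_integralB; [|by ctsf..].
  apply/eqP; refine (@period_integral_derive _
    (fun x => p0 t x * wave_re1 n b e t x + q0 t x * wave_im1 n b e t x) _ _ _ _).
  - move=> x; have [dp dq] := @rs_derive _ _ _ _ _ _ sol 0%N t x isT tT.
    have dc := is_derive_compf (is_derive_phase_space n 0 t x) (is_derive_cos _).
    have ds := is_derive_compf (is_derive_phase_space n 0 t x) (is_derive_sin _).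
    eapply is_derive_congr; first by rewrite /wave_re1 /wave_im1; derf.
    by rewrite /wave_re1 /wave_im1 /=; ring.
  - by ctsf.
  - have [-> ->] := @rs_periodic _ _ _ _ _ _ sol 0%N t isT tT.
    by rewrite /wave_re1 /wave_im1 /phase cos_periodn sin_periodn mulr0 add0r.
have -> : \oint (wave_distance t) = mass t + grad t
    + 2 * pi * (e * e * (1 + b * b)) + 2 * pi * (N * N * (e * e * (b * b)))
    - 2 * e * mode p q 0 0 t - 2 * (e * b) * mode p q n 0 t
    - 2 * (N * N * (e * b) * mode p q n 0 t).
  rewrite -grad_mode -(integral_wave_mass b e n_gt0 t) -(integral_wave_gradient n b e t).
  rewrite mode0E /mass /grad -!(period_integralD, period_integralZ, period_integralB);
    try by ctsf.
  apply: eq_period_integral => x.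
  by rewrite /wave_distance /wave_re /wave_im; ring.
have [i0 in0 _] := initial_mode.
have := mode_drift 0 (leq0n n) tT; have := mode_drift 0 (leqnn n) tT.
rewrite i0 in0 !ler_norml => /andP[m1 _] /andP[m2 _].
have := grad_le tT; rewrite (massE tT) => g4.
set D := drift_bound * T in m1 m2 *; set m := mode p q n 0 t in m1 *.
have h0 : 2 * e * (2 * pi * e - mode p q 0 0 t) <= 2 * e * (D * e ^+ 3).
  by rewrite ler_wpM2l ?mulr_ge0//; lra.
have h1 : 2 * (e * b) * (2 * pi * (e * b) - m) <= 2 * (e * b) * (D * e ^+ 3).
  by rewrite ler_wpM2l ?mulr_ge0//; lra.
have h2 : N * N * (2 * (e * b) * (2 * pi * (e * b) - m))
    <= N * N * (2 * (e * b) * (D * e ^+ 3)).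
  by rewrite ler_wpM2l// mulr_ge0.
rewrite /distance_bound -/D; move: h0 h1 h2 g4.
by rewrite (_ : e ^+ 4 = e * e ^+ 3) -?exprS//; lra.
Qed.

Definition wave_bound : R := (1 + b) * (1 + N).

Let wave_le t x : [/\ `|wave_re n b e t x| <= wave_bound * e,
  `|wave_im n b e t x| <= wave_bound * e, `|wave_re1 n b e t x| <= wave_bound * e &
  `|wave_im1 n b e t x| <= wave_bound * e].
Proof.
have e0 : 0 <= e by case/andP: e01.
have N0 : 0 <= N by []. have bN : 0 <= b * N by exact: mulr_ge0.
have bz (z : R) : `|z| <= 1 -> `|b * z| <= b.
  by move=> z1; rewrite normrM (ger0_norm b_ge0) ler_piMr.
have bc := bz _ (cos_max (phase n 0 t x)); have bs := bz _ (sin_max (phase n 0 t x)).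
have ez (z c : R) : `|z| <= c -> `|e * z| <= c * e.
  by move=> zc; rewrite normrM (ger0_norm e0) mulrC ler_wpM2r.
have eN (z : R) : `|z| <= b -> `|N * (e * z)| <= wave_bound * e.
  move=> zb; rewrite mulrCA; apply: ez; rewrite normrM normr_nat.
  by rewrite (le_trans (ler_wpM2l N0 zb))// /wave_bound; move: N0 bN b_ge0; lra.
split; rewrite /wave_re /wave_im /wave_re1 /wave_im1.
- apply: ez; rewrite (le_trans (ler_normD _ _))// normr1.
  by rewrite /wave_bound; lra.
- by apply: ez; rewrite /wave_bound; lra.
- by rewrite normrN; exact: eN.
- exact: eN.
Qed.

(** * Growth of the resonant mode *)

Definition perturbation_bound : R :=
  48 * (1 + N) * (sup_bound + sup_bound * wave_bound + wave_bound * wave_bound).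

Definition resonance_error : R :=
  perturbation_bound * (2 * pi + distance_bound) + 96 * pi * sup_bound ^+ 5.

(** Replacing the solution by the wave costs [e^4] plus the squared distance pointwise, and the
    latter integrates to [O(e^4)]. The quintic terms are [O(e^5)], hence [O(e^4)] as [e <= 1]. *)
Lemma mode_density_asymptotics t : `|t| < T ->
  `|\oint (mode_density p q n (pi / 2) t) + 2 * pi * (e ^+ 3 * resonance n b)|
    <= resonance_error * e ^+ 4.
Proof.
move=> tT; have [cp0 cq0 cp1 cq1] := space_continuous tT.
have [cP cQ cP1 cQ1] := wave_continuous t.
have S0 := h1_bound_gt0; have e0 : 0 <= e by case/andP: e01.
have e1 : e <= 1 by case/andP: e01.
have A0 : 0 <= sup_bound by exact: ltW sup_bound_gt0.
have N0 : 0 <= N by []. have B0 : 0 <= wave_bound by rewrite mulr_ge0 ?addr_ge0.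
have cc := @continuous_phase_cos R n (pi / 2) t.
have cs := @continuous_phase_sin R n (pi / 2) t.
have cW : continuous (wave_distance t) by rewrite /wave_distance; ctsf.
have cm : continuous (mode_density p q n (pi / 2) t) by rewrite /mode_density /cubic; ctsf.
have cw : continuous (wave_density n b e t) by rewrite /wave_density /cubic; ctsf.
rewrite -[X in _ + X]opprK -(integral_wave_density n b e t) -period_integralB//.
set H := perturbation_bound; set A := sup_bound.
have H0 : 0 <= H.
  have AB : 0 <= sup_bound * wave_bound by exact: mulr_ge0.
  have BB : 0 <= wave_bound * wave_bound by exact: mulr_ge0.
  by rewrite /H /perturbation_bound; apply: mulr_ge0; [apply: mulr_ge0|]; lra.
apply: (@le_trans _ _ (\oint (fun x => H * (e ^+ 4 + wave_distance t x) + 48 * A ^+ 5 * e ^+ 4))).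
  apply: le_norm_period_integral; [exact: continuous_subf|by ctsf|move=> x x01].
  have [pA qA] := sup_le tT x01; have [PB QB P1B Q1B] := wave_le t x.
  have kN : `|N| <= N by rewrite normr_nat.
  have kN' : `|- N| <= N by rewrite normrN.
  have WE : (p0 t x - wave_re n b e t x) * (p0 t x - wave_re n b e t x) +
    (q0 t x - wave_im n b e t x) * (q0 t x - wave_im n b e t x) +
    ((p1 t x - wave_re1 n b e t x) * (p1 t x - wave_re1 n b e t x) +
     (q1 t x - wave_im1 n b e t x) * (q1 t x - wave_im1 n b e t x)) <= wave_distance t x by [].
  have z1 := cubic_perturbation kN A0 B0 e01 pA qA PB QB P1B Q1B WE.
  have WE' : (q0 t x - wave_im n b e t x) * (q0 t x - wave_im n b e t x) +
    (p0 t x - wave_re n b e t x) * (p0 t x - wave_re n b e t x) +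
    ((q1 t x - wave_im1 n b e t x) * (q1 t x - wave_im1 n b e t x) +
     (p1 t x - wave_re1 n b e t x) * (p1 t x - wave_re1 n b e t x)) <= wave_distance t x.
    by rewrite /wave_distance; lra.
  have z2 := cubic_perturbation kN' A0 B0 e01 qA pA QB PB Q1B P1B WE'.
  pose r := p0 t x * p0 t x + q0 t x * q0 t x.
  have r_ge0 : 0 <= r by rewrite addr_ge0.
  have AA z : `|z| <= A * e -> z * z <= A ^+ 2 * e ^+ 2.
    move=> zA; rewrite -expr2 -exprMn -real_normK ?num_real// ler_sqr ?nnegrE//.
    exact: mulr_ge0.
  have r2 : r <= 2 * (A ^+ 2 * e ^+ 2) by have := AA _ pA; have := AA _ qA; rewrite /r; lra.
  have quint z : `|z| <= A * e -> `|6 * (r * r * z)| <= 24 * A ^+ 5 * e ^+ 4.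
    move=> zA; rewrite !normrM (ger0_norm r_ge0) [`|6|]ger0_norm//.
    have h := ler_pM (mulr_ge0 r_ge0 r_ge0) (normr_ge0 z)
      (ler_pM r_ge0 r_ge0 r2 r2) zA.
    rewrite (le_trans (ler_wpM2l _ h))//.
    rewrite (_ : 6 * (_ * (A * e)) = 24 * A ^+ 5 * e ^+ 4 * e); last by ring.
    by rewrite ler_piMr// !mulr_ge0// exprn_ge0.
  rewrite /mode_density /wave_density -/r.
  set c := cos _; set s := sin _; set u1 := cubic _ _ _ _ _ in z2 *.
  set v1 := cubic _ (wave_im _ _ _ _ _) _ _ _ in z2 *.
  set u2 := cubic _ _ _ _ _ in z1 *; set v2 := cubic _ _ _ _ _ in z1 *.
  have -> : (u1 + 6 * (r * r * q0 t x)) * c - (u2 + 6 * (r * r * p0 t x)) * s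
      - (v1 * c - v2 * s) = (u1 - v1 + 6 * (r * r * q0 t x)) * c
      - (u2 - v2 + 6 * (r * r * p0 t x)) * s by ring.
  have total u v w (z d : R) : `|u| <= v -> `|z| <= w -> `|d| <= 1 -> `|(u + z) * d| <= v + w.
    move=> uv zw d1; rewrite normrM -[leRHS]mulr1 ler_pM//.
    by rewrite (le_trans (ler_normD _ _))// lerD.
  rewrite (le_trans (ler_normB _ _))//.
  rewrite (le_trans (lerD (total _ _ _ _ _ z2 (quint _ qA) (cos_max _))
                          (total _ _ _ _ _ z1 (quint _ pA) (sin_max _))))//.
  by rewrite /H /perturbation_bound -/A le_eqVlt; apply/orP; left; apply/eqP; ring.
rewrite period_integralD; [|by ctsf..].
rewrite period_integralZ; last by ctsf.
rewrite period_integralD; [|by ctsf..].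
rewrite !period_integral_cst /resonance_error -/H -/A.
have := ler_wpM2l H0 (wave_distance_le tT); lra.
Qed.

Lemma resonant_mode_asymptotics t : `|t| < T ->
  `|mode p q n (pi / 2) t + 2 * pi * (e ^+ 3 * resonance n b) * t|
    <= resonance_error * T * e ^+ 4.
Proof.
move=> tT; have e40 : 0 <= e ^+ 4 by case/andP: e01 => e0 _; exact: exprn_ge0.
have := @mean_value_bound R _ _ T (- (2 * pi * (e ^+ 3 * resonance n b)))
  (resonance_error * e ^+ 4) t (fun s sT => is_derive_mode sol n (pi / 2) sT).
have [_ _ ->] := initial_mode; rewrite subr0 mulNr => H.
have H1 s : `|s| < T -> `|\oint (mode_density p q n (pi / 2) s)
    - - (2 * pi * (e ^+ 3 * resonance n b))| <= resonance_error * e ^+ 4.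
  by move=> sT; rewrite opprK; exact: mode_density_asymptotics.
rewrite -[X in `|_ + X|]opprK; apply: (le_trans (H H1 tT)).
have err0 : 0 <= resonance_error * e ^+ 4.
  exact: le_trans (mode_density_asymptotics zero_strip).
by rewrite [leRHS]mulrAC (ler_wpM2l err0)// ltW.
Qed.

End SmallSolution.

(** * Third differences of C^3 maps *)

Section ThirdDifference.
Context {R : realType}.

(** Composition with a real functional reduces a map between normed spaces, restricted to a ray, to
    a real function of one variable, for which the mean value theorem is an equality. *)
Definition bounded_functional (U : normedModType R) (c : R) (M : U -> R) :=
  [/\ 0 <= c, forall (a : R) u v, M (a *: u + v) = a * M u + M v &
      forall u, `|M u| <= c * `|u|].

Section BoundedFunctional.
Variables (U : normedModType R) (c : R) (M : U -> R).
Hypothesis bM : bounded_functional c M.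

Let Mlin (a : R) u v : M (a *: u + v) = a * M u + M v. Proof. by case: bM. Qed.
Let Mle u : `|M u| <= c * `|u|. Proof. by case: bM. Qed.

Lemma bounded_functional0 : M 0 = 0.
Proof. by have := Mlin (-1) 0 0; rewrite scaler0 addr0 mulN1r addNr. Qed.

Lemma bounded_functionalZ (a : R) u : M (a *: u) = a * M u.
Proof. by rewrite -[a *: u]addr0 Mlin bounded_functional0 addr0. Qed.

Lemma bounded_functionalB u v : M (u - v) = M u - M v.
Proof. by rewrite addrC -scaleN1r Mlin mulN1r addrC. Qed.

Lemma bounded_functional_continuous : continuous M.
Proof.
move=> x; apply/cvgrPdist_lt => e e0.
have c1 : 0 < `|c| + 1 by rewrite ltr_wpDl.
near=> y.
rewrite -bounded_functionalB.
rewrite (le_lt_trans (Mle _))// (@le_lt_trans _ _ ((`|c| + 1) * `|x - y|))//.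
  by rewrite ler_wpM2r// (le_trans (ler_norm _))// lerDl.
rewrite -ltr_pdivlMl//; near: y; apply: cvgr_dist_lt; first exact: cvg_id.
by rewrite mulr_gt0// invr_gt0.
Unshelve. all: end_near. Qed.

Lemma is_derive_functional (V : normedModType R) (F : V -> U) (DF : V -> blin V U)
    (phi : V) (e : R) : (forall x, differentiable F x) ->
  (forall x, DF x = 'd F x :> (V -> U)) ->
  is_derive e 1 (fun s : R => M (F (s *: phi))) (M (DF (e *: phi) phi)).
Proof.
move=> dF DFE.
have dv : derivable F (e *: phi) phi by exact: diff_derivable.
have lim : (fun h : R => h^-1 *: (F (h *: phi + e *: phi) - F (e *: phi))) @ 0^'
    --> DF (e *: phi) phi.
  by rewrite DFE -deriveE.
have limM : (fun h : R => h^-1 *: (M (F ((h *: 1 + e) *: phi)) - M (F (e *: phi)))) @ 0^'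
    --> M (DF (e *: phi) phi).
  have := cvg_comp _ _ lim (@bounded_functional_continuous (DF (e *: phi) phi)).
  apply: cvg_trans.
  apply: near_eq_cvg; apply: nearW => h /=.
  rewrite bounded_functionalZ bounded_functionalB scalerDl.
  by rewrite /GRing.scale/= mulr1.
by split; [apply/cvg_ex; exists (M (DF (e *: phi) phi))|exact: cvg_lim limM].
Qed.

(** The derivative along the ray is again a functional of this kind, now applied to [DF]; so
    [is_derive_functional] can be iterated, at the price of a factor [|phi|] each time. *)
Lemma bounded_functional_eval (V : normedModType R) (phi : V) :
  bounded_functional (c * `|phi|) (fun A : blin V U => M (A phi)).
Proof.
have c0 : 0 <= c by case: bM.
split; first exact: mulr_ge0; first by move=> a A B; rewrite -Mlin.
move=> A; rewrite (le_trans (Mle _))// mulrAC -mulrA.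
by apply: (ler_wpM2l c0); exact: le_opnorm.
Qed.

End BoundedFunctional.

(** [K] and [d] come from continuity of the third derivative at [0] and are fixed before [L], [phi]
    and [e]; the growth in [n] contradicts this uniformity. *)
Lemma Cn3_third_difference (V W : normedModType R) (f : V -> W) : Cn 3 f ->
  exists K : R, 0 < K /\ exists d : R, 0 < d /\
    forall (c : R) (L : W -> R) (phi : V) (e : R),
      bounded_functional c L -> 0 <= e -> 3 * e * `|phi| < d ->
      `|L (f ((3 * e) *: phi)) - 3 * L (f ((2 * e) *: phi)) + 3 * L (f (e *: phi))
        - L (f (0 *: phi))| <= K * c * (`|phi| * e) ^+ 3.
Proof.
move=> [df [Df [DfE [dDf [D2f [D2fE [dD2f [D3f [D3fE cD3f]]]]]]]]].
pose K := `|D3f 0| + 1.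
have [d d0 dK] : exists2 d, 0 < d & forall v, `|v| < d -> `|D3f v| <= K.
  have /cvgrPdist_le/(_ _ ltr01) := cD3f 0.
  move=> /nbhs_normP[d /= d0 dP]; exists d => // v vd.
  have /= := dP v; rewrite /ball_ /= sub0r normrN => /(_ vd) h.
  rewrite /K -lerBlDl (le_trans _ h)// distrC.
  exact: lerB_dist.
exists K; split; first by rewrite ltr_wpDl.
exists d; split=> // c L phi e bL e0 ed; have [c0 _ _] := bL.
have bL1 := bounded_functional_eval bL phi.
have bL2 := bounded_functional_eval bL1 phi.
have bL3 := bounded_functional_eval bL2 phi.
have [z /andP[z0 z3] ->] := third_difference e0
  (fun s => is_derive_functional bL phi s df DfE)
  (fun s => is_derive_functional bL1 phi s dDf D2fE)
  (fun s => is_derive_functional bL2 phi s dD2f D3fE).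
rewrite normrM exprMn mulrA ler_pM//; last by rewrite ger0_norm// exprn_ge0.
have [_ _ bL3le] := bL3; rewrite (le_trans (bL3le _))//.
rewrite (_ : K * c * _ = c * `|phi| * `|phi| * `|phi| * K); last by ring.
rewrite ler_wpM2l ?mulr_ge0// dK// normrZ ger0_norm//.
by rewrite (le_lt_trans _ ed)// ler_wpM2r.
Qed.

End ThirdDifference.

(** * Real and imaginary parts *)

Section ComplexToReal.
Context {R : realType}.
Local Notation C := (Rcomplex R).
Local Notation Re := (@complex.Re R : C -> R).
Local Notation Im := (@complex.Im R : C -> R).

Lemma Rcomplex_normE (z : C) : `|z| = Num.sqrt (Re z ^+ 2 + Im z ^+ 2).
Proof. by case: z. Qed.

Lemma Re_bounded : bounded_functional 1 Re.
Proof.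
split=> // [a u v|u]; first by rewrite linearP.
rewrite mul1r Rcomplex_normE -sqrtr_sqr ler_wsqrtr// lerDl sqr_ge0//.
Qed.

Lemma Im_bounded : bounded_functional 1 Im.
Proof.
split=> // [a u v|u]; first by rewrite linearP.
by rewrite mul1r Rcomplex_normE -sqrtr_sqr ler_wsqrtr// lerDr sqr_ge0.
Qed.

Lemma cvg_Rcomplex {T : Type} (F : set_system T) {FF : Filter F} (f : T -> C) (z : C) :
  (Re \o f) @ F --> Re z -> (Im \o f) @ F --> Im z -> f @ F --> z.
Proof.
move=> fr fi; apply/cvgrPdist_lt => e e0; near=> x.
have rx : `|Re z - Re (f x)| < e / 2.
  by near: x; move/cvgrPdist_lt : fr; apply; rewrite divr_gt0.
have ix : `|Im z - Im (f x)| < e / 2.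
  by near: x; move/cvgrPdist_lt : fi; apply; rewrite divr_gt0.
rewrite Rcomplex_normE !raddfB/=.
set a := Re z - Re (f x) in rx *; set b := Im z - Im (f x) in ix *.
apply: (@le_lt_trans _ _ (`|a| + `|b|)); last by lra.
rewrite -ler_sqr ?nnegrE ?sqrtr_ge0 ?addr_ge0// sqr_sqrtr ?addr_ge0 ?sqr_ge0//.
rewrite -(real_normK (num_real a)) -(real_normK (num_real b)) !expr2.
have := mulr_ge0 (normr_ge0 a) (normr_ge0 b); lra.
Unshelve. all: end_near. Qed.

Lemma is_derive_components (f : R -> C) (x : R) : derivable f x 1 ->
  is_derive x 1 (fun y => Re (f y)) (Re (derive1 f x)) /\
  is_derive x 1 (fun y => Im (f y)) (Im (derive1 f x)).
Proof.
move=> df.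
have lim : (fun h : R => h^-1 *: (f (h *: 1 + x) - f x)) @ 0^' --> derive1 f x.
  by rewrite derive1E.
have comp (M : C -> R) : bounded_functional 1 M ->
    is_derive x 1 (fun y => M (f y)) (M (derive1 f x)).
  move=> bM; have limM : (fun h : R => h^-1 *: (M (f (h *: 1 + x)) - M (f x))) @ 0^'
      --> M (derive1 f x).
    have := cvg_comp _ _ lim (@bounded_functional_continuous _ _ _ _ bM (derive1 f x)).
    apply: cvg_trans; apply: near_eq_cvg; apply: nearW => h /=.
    by rewrite (bounded_functionalZ bM) (bounded_functionalB bM).
  by split; [apply/cvg_ex; exists (M (derive1 f x))|exact: cvg_lim limM].
by split; apply: comp; [exact: Re_bounded|exact: Im_bounded].
Qed.

Lemma is_derive_of_components (f : R -> C) (x : R) (d : C) :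
  is_derive x 1 (fun y => Re (f y)) (Re d) ->
  is_derive x 1 (fun y => Im (f y)) (Im d) -> is_derive x 1 f d.
Proof.
move=> [dr er] [di ei].
have lim : (fun h : R => h^-1 *: (f (h *: 1 + x) - f x)) @ 0^' --> d.
  apply: cvg_Rcomplex.
  - rewrite -er; apply: cvg_trans dr; apply: near_eq_cvg; apply: nearW => h /=.
    by rewrite (bounded_functionalZ Re_bounded) (bounded_functionalB Re_bounded).
  - rewrite -ei; apply: cvg_trans di; apply: near_eq_cvg; apply: nearW => h /=.
    by rewrite (bounded_functionalZ Im_bounded) (bounded_functionalB Im_bounded).
by split; [apply/cvg_ex; exists d|exact: cvg_lim lim].
Qed.

Lemma derive1_conj (f : R -> C) (x : R) : derivable f x 1 ->
  derivable (fun y => conjc (f y) : C) x 1 /\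
  derive1 (fun y => conjc (f y) : C) x = conjc (derive1 f x).
Proof.
move=> df; have [dr di] := is_derive_components df.
have d : is_derive x 1 (fun y => conjc (f y) : C) (conjc (derive1 f x)).
  apply: is_derive_of_components.
    rewrite (_ : (fun y => _) = (fun y => Re (f y))); last by apply/funext => y; case: (f y).
    by case: (derive1 f x) dr.
  rewrite (_ : (fun y => _) = (fun y => - Im (f y))); last by apply/funext => y; case: (f y).
  have -> : Im (conjc (derive1 f x)) = - Im (derive1 f x) by case: (derive1 f x).
  exact: is_derive_oppf.
by rewrite derive1E; case: d => ? ->.
Qed.

Lemma derive1n_shift (f : R -> C) (c : R) j : (forall x, f (x + c) = f x) ->
  forall x, derive1n j f (x + c) = derive1n j f x.
Proof.
move=> fc; elim: j => [//|j IH] x; rewrite !derive1nS /derive1.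
suff -> : (fun h => h^-1 *: (derive1n j f (h + (x + c)) - derive1n j f (x + c))) =
  (fun h => h^-1 *: (derive1n j f (h + x) - derive1n j f x)) by [].
by apply/funext => h; rewrite addrA !IH.
Qed.

(** As a relation it lets [eapply] synthesise the real polynomials [a] and [b] from the shape of
    [z], after which [ring] compares them with the expected form. *)
Definition components (z : C) (a b : R) := Re z = a /\ Im z = b.

Lemma components_self z : components z (Re z) (Im z).
Proof. by []. Qed.

Lemma componentsD y z a b c d : components y a b -> components z c d ->
  components (y + z) (a + c) (b + d).
Proof. by case: y => ? ? [<- <-]; case: z => ? ? [<- <-]. Qed.

Lemma componentsN z a b : components z a b -> components (- z) (- a) (- b).
Proof. by case: z => ? ? [<- <-]. Qed.

Lemma componentsM y z a b c d : components y a b -> components z c d ->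
  components (y * z) (a * c - b * d) (a * d + b * c).
Proof. by case: y => ? ? [<- <-]; case: z => ? ? [<- <-]. Qed.

Lemma componentsZ (k : R) z a b : components z a b ->
  components (k *: z) (k * a) (k * b).
Proof. by case: z => ? ? [<- <-]. Qed.

Lemma components_conj z a b : components z a b -> components (conjc z) a (- b).
Proof. by case: z => ? ? [<- <-]. Qed.

Lemma components_Conj (z : R[i]) a b :
  components z a b -> components (Num.conj z) a (- b).
Proof. exact: components_conj. Qed.

Lemma components_i : components 'i%C 0 1.
Proof. by []. Qed.

Lemma components_nat n : components n%:R n%:R 0.
Proof. by split; rewrite raddfMn//= mul0rn. Qed.

Ltac split_components := lazymatch goal with
  | |- components (_ + _) _ _ => eapply componentsD; split_components
  | |- components (- _) _ _ => eapply componentsN; split_components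
  | |- components (_ * _) _ _ => eapply componentsM; split_components
  | |- components (_ *: _) _ _ => eapply componentsZ; split_components
  | |- components (conjc _) _ _ => eapply components_conj; split_components
  | |- components (Num.conj _) _ _ => eapply components_Conj; split_components
  | |- components _%:R _ _ => eapply components_nat
  | |- components 'i%C _ _ => eapply components_i
  | |- _ => eapply components_self
  end.

Lemma strip_continuous_component (M : C -> R) T (v : R -> R -> C) :
  bounded_functional 1 M ->
  {within strip T, continuous (fun z => v z.1 z.2)} ->
  strip_continuous T (fun t x => M (v t x)).
Proof.
move=> bM; rewrite continuous_open_subspace => [cv t x tT|]; last first.
  rewrite /strip (_ : [set z | _] = (fun z : R * R => `|z.1|) @^-1` [set y | y < T])//.
  apply: open_comp; last exact: open_lt.
  by move=> z _; apply: cvg_norm; exact: cvg_fst.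
apply: (@continuous_comp _ _ _ (fun z => v z.1 z.2) M).
  by apply: cv; rewrite inE.
exact: (@bounded_functional_continuous _ _ _ _ bM).
Qed.

Lemma classical_real_solution T (u : R -> R -> C) : classical_solution T u ->
  real_solution T (fun j t x => Re (derive1n j (u t) x))
    (fun j t x => Im (derive1n j (u t) x))
    (fun t x => Re (derive1 (u ^~ x) t)) (fun t x => Im (derive1 (u ^~ x) t)).
Proof.
move=> [per der ct cx eqn]; split.
- move=> j t x j4 tT; have [_ /(_ j j4) d] := der t x tT.
  exact: is_derive_components d.
- by move=> t x tT; have [d _] := der t x tT; exact: is_derive_components d.
- move=> j t _ tT; have := derive1n_shift j (per t tT) 0.
  by rewrite add0r => ->.
- move=> j j4; split; apply: strip_continuous_component (cx j j4).
    exact: Re_bounded.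
  exact: Im_bounded.
- split; apply: (@strip_continuous_component _ T (fun t x => derive1 (u ^~ x) t)) ct.
    exact: Re_bounded.
  exact: Im_bounded.
move=> t x tT; have := eqn t x tT; rewrite /nls4 /nls4_nonlin.
have conj1 : derive1 (fun y => conjc (u t y) : C) = fun y => conjc (derive1 (u t) y).
  apply/funext => y; have [_ /(_ 0%N isT) d] := der t y tT.
  exact: (derive1_conj d).2.
have -> : derive1n 2 (fun y => conjc (u t y) : C) x = conjc (derive1n 2 (u t) x).
  rewrite derive1nS derive1n1 conj1.
  have [_ /(_ 1%N isT) d] := der t x tT.
  exact: (derive1_conj d).2.
rewrite (_ : `|u t x| ^+ 4 = `|u t x| ^+ 2 * `|u t x| ^+ 2); last by rewrite -exprD.
rewrite !Rcomplex_normE !sqr_sqrtr ?addr_ge0 ?sqr_ge0//.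
rewrite -[derive1 (u t) x]/(derive1n 1 (u t) x) -[u t x]/(derive1n 0 (u t) x).
move: (derive1 (u ^~ x) t) (derive1n 0 (u t) x) (derive1n 1 (u t) x)
  (derive1n 2 (u t) x) (derive1n 4 (u t) x) => ut u0 u1 u2 u4 E.
have EL : exists a b, components ('i%C * ut - u4) a b /\
    a = - Im ut - Re u4 /\ b = Re ut - Im u4.
  eexists; eexists; split; first by split_components.
  by split; ring.
have [aL [bL [[<- <-] [eL fL]]]] := EL.
move: eL fL; rewrite E !expr2.
match goal with |- complex.Re ?z = _ -> _ =>
  have ER : exists a b, components z a b /\
    a = nls4_component (Re u0) (Re u1) (Re u2) (Im u0) (Im u1) (Im u2) /\
    b = nls4_component (Im u0) (Im u1) (Im u2) (Re u0) (Re u1) (Re u2) end.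
  eexists; eexists; split; first by split_components.
  by rewrite /nls4_component; split; ring.
have [aR [bR [[-> ->] [-> ->]]]] := ER.
by move=> eL fL; split; lra.
Qed.

End ComplexToReal.

(** * Fourier-Lebesgue norms *)

Section CountingNorm.
Context {R : realType}.
Local Notation mu := (@counting int R).
Implicit Types (f : int -> R) (k : int) (p : \bar R).

Lemma counting_set1 k : mu [set k] = 1%E.
Proof.
rewrite /counting asboolT; last exact: finite_set1.
by rewrite fset_set1 finmap.cardfs1.
Qed.

Lemma counting_ae (P : set int) : {ae mu, forall k, P k} -> forall k, P k.
Proof.
move=> [A [_ A0 PA]] k; apply: contrapT => nPk.
have kA : [set k] `<=` A by move=> _ ->; exact: PA.
have : (mu [set k] <= mu A)%E by apply: le_measure; rewrite ?inE.
by rewrite counting_set1 [X in (_ <= X)%E]A0 lee_fin ler10.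
Qed.

Lemma integral_counting_set1 f k :
  (\int[mu]_(x in [set k]) (f x)%:E = (f k)%:E)%E.
Proof.
rewrite (@eq_integral _ _ _ _ _ (cst (f k)%:E)); last by move=> x; rewrite inE => ->.
by rewrite integral_cst// [X in (_ * X)%E]counting_set1 mule1.
Qed.

Lemma Lnorm_counting_ge f p k : (1 <= p)%E ->
  (`|f k|%:E <= 'N[mu]_p [EFin \o f])%E.
Proof.
move=> p1; rewrite unlock; case: p p1 => // [p p1|_].
- have p0 : 0 < p by rewrite (lt_le_trans ltr01).
  set F := fun x => (`|(EFin \o f) x| `^ p)%E.
  have FE x : F x = (`|f x| `^ p)%:E by [].
  have Fk : (F k <= \int[mu]_x F x)%E.
    rewrite FE -(integral_counting_set1 (fun x => `|f x| `^ p) k).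
    under eq_integral do rewrite -FE.
    apply: ge0_subset_integral => //.
    by move=> x _; exact: poweR_ge0.
  have -> : (`|f k|%:E = F k `^ p^-1)%E.
    by rewrite FE poweR_EFin -powRrM divff ?gt_eqF// powRr1.
  by apply: gt0_ler_poweR; rewrite ?invr_ge0 ?(ltW p0)// in_itv/= leey andbT
    ?integral_ge0// => *; exact: poweR_ge0.
- case: ifPn => [_|]; last first.
    have : (mu [set k] <= mu setT)%E by apply: le_measure; rewrite ?inE.
    rewrite counting_set1 => h /negP[]; exact: lt_le_trans h.
  exact: (counting_ae (ess_sup_ge mu (abse \o (EFin \o f))) k).
Qed.

(** With [Lnorm_counting_ge], the norm of a sequence supported at one point is seen not to depend on
    [p], hence not on [r]. *)
Lemma Lnorm_counting_point f p k : (1 <= p)%E ->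
  (forall j, j != k -> f j = 0) -> ('N[mu]_p [EFin \o f] <= `|f k|%:E)%E.
Proof.
move=> p1 f0; rewrite unlock; case: p p1 => // [p p1|_].
- have p0 : 0 < p by rewrite (lt_le_trans ltr01).
  set F := fun x => (`|(EFin \o f) x| `^ p)%E.
  have FE x : F x = (`|f x| `^ p)%:E by [].
  have -> : (\int[mu]_x F x = F k)%E.
    rewrite [RHS]FE -(integral_counting_set1 (fun x => `|f x| `^ p) k).
    under [RHS]eq_integral do rewrite -FE.
    rewrite [RHS]integral_mkcond.
    apply: eq_integral => x _; rewrite patchE; case: ifPn => // xk.
    have fx : f x = 0 by apply: f0; apply/eqP => xk'; move: xk; rewrite xk' => /negP[]; rewrite inE.
    by rewrite FE fx normr0 powR0// gt_eqF.
  by rewrite FE poweR_EFin -powRrM divff ?gt_eqF// powRr1.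
- case: ifPn => [_|_]; last by rewrite lee_fin.
  apply/ess_supP; apply: nearW => j /=; rewrite lee_fin.
  by have [->//|jk] := eqVneq j k; rewrite (f0 _ jk) normr0.
Qed.

End CountingNorm.

Section FourierLebesgueModes.
Context {R : realType} (s : R) (r : \bar R) (r1 : (1 <= r)%E).
Local Notation C := (Rcomplex R).
Local Notation X := (FL s r1).

Lemma bracket_gt0 k : 0 < bracket k :> R.
Proof. by rewrite /bracket sqrtr_gt0 ltr_pwDl ?sqr_ge0. Qed.

Lemma FL_normE (a : X) : `|a|%:E = FL_norm s r (a : int -> C).
Proof.
rewrite -[`|a|]/(fine (FL_norm s r (a : int -> C))) fineK//.
by rewrite ge0_fin_numE ?Lnorm_ge0//; exact: (valP a).
Qed.

Lemma FL_coef_le (a : X) k : bracket k `^ s * `|a k| <= `|a|.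
Proof.
have := @Lnorm_counting_ge R (weight s a) _ k (hoelder_conj_ge1 r1).
rewrite -lee_fin FL_normE; apply: le_trans; rewrite lee_fin.
by rewrite /weight normrM !ger0_norm// powR_ge0.
Qed.

Definition delta_coef (k : int) (c : C) (j : int) : C := if j == k then c else 0.

Lemma FL_norm_delta k c :
  (FL_norm s r (delta_coef k c) <= (bracket k `^ s * `|c|)%:E)%E.
Proof.
have := @Lnorm_counting_point R (weight s (delta_coef k c)) _ k (hoelder_conj_ge1 r1).
rewrite /FL_norm => h; apply: (le_trans (h _)).
  by move=> j jk; rewrite /weight /delta_coef (negbTE jk) normr0 mulr0.
by rewrite lee_fin /weight /delta_coef eqxx normrM !ger0_norm// powR_ge0.
Qed.

Lemma delta_coef_pred k c : delta_coef k c \in FL_pred s r.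
Proof. by rewrite unfold_in (le_lt_trans (FL_norm_delta k c))// ltry. Qed.

Definition FL_delta k c : X := MkFL r1 (delta_coef_pred k c).

Lemma FL_delta_norm k c : `|FL_delta k c| <= bracket k `^ s * `|c|.
Proof. by rewrite -lee_fin FL_normE; exact: FL_norm_delta. Qed.

Lemma FL_coef_bounded k (a b : R) : a ^+ 2 + b ^+ 2 = 1 ->
  bounded_functional (bracket k `^ s)^-1
    (fun v : X => a * complex.Im (v k) - b * complex.Re (v k)).
Proof.
move=> ab; have B0 : 0 < bracket k `^ s by rewrite powR_gt0// bracket_gt0.
split; first by rewrite invr_ge0 ltW.
- move=> c u v; rewrite (_ : (c *: u + v) k = c *: u k + v k) //.
  have [-> ->] := componentsD (componentsZ c (components_self (u k))) (components_self (v k)).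
  by ring.
- move=> v; have h := FL_coef_le v k.
  have ab1 : `|a * complex.Im (v k) - b * complex.Re (v k)| <= `|v k|.
    rewrite -ler_sqr ?nnegrE// real_normK ?num_real// Rcomplex_normE.
    rewrite sqr_sqrtr ?addr_ge0 ?sqr_ge0// -[leRHS]mul1r -ab.
    (* The squares of the two rotated components add up to [|v k|^2]; this is the component
       discarded. *)
    have := sqr_ge0 (a * complex.Re (v k) + b * complex.Im (v k)).
    by rewrite !expr2; lra.
  by rewrite (le_trans ab1)// -ler_pdivrMl ?invrK ?invr_gt0.
Qed.

End FourierLebesgueModes.

(** * Fourier coefficients of the datum *)

Section WaveDatum.
Context {R : realType}.
Local Notation C := (Rcomplex R).
Local Notation Re := (@complex.Re R : C -> R).
Local Notation Im := (@complex.Im R : C -> R).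
Local Notation "'\oint' f" := (period_integral f) (at level 10, f at next level).

Section Frequency.
Variables (n : nat).

(** All six coefficients are kept so that the family is closed under differentiation, which gives
    smoothness by induction. *)
Definition trig (a b c d f g x : R) : C :=
  ((a + b * cos (phase n 0 0 x) + c * sin (phase n 0 0 x))
  +i* (d + f * cos (phase n 0 0 x) + g * sin (phase n 0 0 x)))%C.

Lemma is_derive_trig (a b c d f g x : R) : is_derive x 1 (trig a b c d f g)
  (trig 0 (c * n%:R) (- (b * n%:R)) 0 (g * n%:R) (- (f * n%:R)) x).
Proof.
have dc := is_derive_compf (is_derive_phase_space n 0 0 x) (is_derive_cos _).
have ds := is_derive_compf (is_derive_phase_space n 0 0 x) (is_derive_sin _).
have comb (u v w : R) : is_derive x 1
    (fun x => u + v * cos (phase n 0 0 x) + w * sin (phase n 0 0 x))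
    (0 + w * n%:R * cos (phase n 0 0 x) + - (v * n%:R) * sin (phase n 0 0 x)).
  by eapply is_derive_congr; [derf|rewrite /=; ring].
by apply: is_derive_of_components; exact: comb.
Qed.

Lemma smooth_trig a b c d f g : smooth (trig a b c d f g).
Proof.
suff H k : exists a' b' c' d' f' g',
    derive1n k (trig a b c d f g) = trig a' b' c' d' f' g'.
  move=> k x; have [a' [b' [c' [d' [f' [g' ->]]]]]] := H k.
  by have [] := is_derive_trig a' b' c' d' f' g' x.
elim: k => [|k [a' [b' [c' [d' [f' [g' E]]]]]]]; first by exists a, b, c, d, f, g.
rewrite derive1nS E; do 6 eexists; apply/funext => x; rewrite derive1E.
by have [_ ->] := is_derive_trig a' b' c' d' f' g' x; reflexivity.
Qed.

Lemma periodic_trig a b c d f g : Defs.periodic (trig a b c d f g).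
Proof.
move=> x; rewrite /trig.
have -> : phase n 0 0 (x + 2 * pi) = n%:R * (2 * pi) + phase n 0 0 x :> R.
  by rewrite /phase; ring.
by rewrite cos_periodn sin_periodn.
Qed.

End Frequency.

Lemma continuous_scaled (a : R) : continuous (fun x => cos (a * x)) /\
  continuous (fun x => sin (a * x)).
Proof.
have d x := is_derive_mulf (is_derive_cstf a x) (is_derive_id x 1).
by split=> x; [exact: is_derive_continuous (is_derive_compf (d x) (is_derive_cos _))
  |exact: is_derive_continuous (is_derive_compf (d x) (is_derive_sin _))].
Qed.

Lemma integral_frequency (m : int) :
  \oint (fun x : R => cos (m%:~R * x)) = (if m == 0 then 2 * pi else 0) /\
  \oint (fun x : R => sin (m%:~R * x)) = 0.
Proof.
have [->|m0] := eqVneq m 0.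
  rewrite -[2 * pi]mul1r -[X in _ /\ _ = X](mul0r (2 * pi)) -!period_integral_cst.
  by split; apply: eq_period_integral => x; rewrite mul0r ?cos0 ?sin0.
have pos (k : nat) : (0 < k)%N -> \oint (fun x : R => cos (k%:R * x)) = 0 /\
    \oint (fun x : R => sin (k%:R * x)) = 0.
  move=> k0; split; [rewrite -[RHS](@integral_phase_cos R k k0 0 0)|
    rewrite -[RHS](@integral_phase_sin R k k0 0 0)];
  by apply: eq_period_integral => x; rewrite /phase mulr0 !addr0.
case: m m0 => k k0.
- by apply: pos; rewrite lt0n.
- rewrite NegzE; have [c s] := pos k.+1 isT; rewrite -[X in _ = X /\ _]c.
  have [_ cn] := continuous_scaled k.+1%:R.
  split; first by apply: eq_period_integral => x; rewrite mulrNz mulNr cosN.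
  rewrite -[RHS](mulr0 (-1)) -s -period_integralZ//.
  by apply: eq_period_integral => x; rewrite mulrNz mulNr sinN mulN1r.
Qed.

Lemma fourier_coef_components (f : R -> C) (k : int) :
  components (fourier_coef f k)
    ((2 * pi)^-1 * \oint (fun x => Re (f x) * cos (k%:~R * x) + Im (f x) * sin (k%:~R * x)))
    ((2 * pi)^-1 * \oint (fun x => Im (f x) * cos (k%:~R * x) - Re (f x) * sin (k%:~R * x))).
Proof.
split.
  rewrite [LHS]/=; congr (_ * _); apply: eq_period_integral => x.
  by case: (f x) => a b /=; rewrite cosN sinN; ring.
rewrite [LHS]/=; congr (_ * _); apply: eq_period_integral => x.
by case: (f x) => a b /=; rewrite cosN sinN; ring.
Qed.

Definition wave_datum n (b e : R) : R -> C := trig n e (e * b) 0 0 0 (e * b).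

Lemma wave_datumE n b e x :
  wave_datum n b e x = (wave_re n b e 0 x +i* wave_im n b e 0 x)%C.
Proof. by rewrite /wave_datum /trig /wave_re /wave_im; congr (_ +i* _)%C; ring. Qed.

Lemma fourier_wave_datum (n : nat) b e (k : int) : (0 < n)%N ->
  fourier_coef (wave_datum n b e) k =
  e *: (delta_coef 0 1 k + delta_coef n%:Z (b +i* 0)%C k).
Proof.
move=> n0; have [fr fi] := fourier_coef_components (wave_datum n b e) k.
have [ck sk] := integral_frequency k; have [cnk snk] := integral_frequency (n%:Z - k).
have [kc ks] := continuous_scaled k%:~R; have [nkc nks] := continuous_scaled (n%:Z - k)%:~R.
have pi2 := @twopi_gt0 R.
(* Writing [n x] as [(n - k) x + k x] makes the product with [exp(-ikx)] collapse to the frequency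
   [n - k]. *)
have ph x : cos (phase n 0 0 x) = cos ((n%:Z - k)%:~R * x) * cos (k%:~R * x) -
      sin ((n%:Z - k)%:~R * x) * sin (k%:~R * x) /\
    sin (phase n 0 0 x) = sin ((n%:Z - k)%:~R * x) * cos (k%:~R * x) +
      cos ((n%:Z - k)%:~R * x) * sin (k%:~R * x) :> R.
  rewrite -cosD -sinD -mulrDl -intrD subrK /phase mulr0 !addr0.
  by rewrite -pmulrn.
have Er : Re (fourier_coef (wave_datum n b e) k) =
    e * ((k == 0)%:R + b * (k == n%:Z)%:R).
  rewrite fr (_ : \oint _ = \oint (fun x => e * cos (k%:~R * x) +
    e * b * cos ((n%:Z - k)%:~R * x))).
    rewrite period_integralD ?period_integralZ ?ck ?cnk//; try by ctsf.
    rewrite subr_eq0 [n%:Z == k]eq_sym.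
    have ifE (c : bool) : (if c then 2 * pi else 0) = 2 * pi * c%:R :> R.
      by case: c; rewrite ?mulr1 ?mulr0.
    rewrite !ifE; have := @pi_gt0 R; move: (pi : R) => P P0.
    by field; rewrite gt_eqF.
  apply: eq_period_integral => x; rewrite wave_datumE /wave_re /wave_im /=.
  have [-> ->] := ph x.
  have cs := cos2Dsin2 (k%:~R * x); rewrite !expr2 in cs.
  transitivity (e * cos (k%:~R * x) + e * b * cos ((n%:Z - k)%:~R * x) *
    (cos (k%:~R * x) * cos (k%:~R * x) + sin (k%:~R * x) * sin (k%:~R * x))).
    by ring.
  by rewrite cs mulr1.
have Ei : Im (fourier_coef (wave_datum n b e) k) = 0.
  rewrite fi (_ : \oint _ = \oint (fun x => - e * sin (k%:~R * x) +
    e * b * sin ((n%:Z - k)%:~R * x))).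
    by rewrite period_integralD ?period_integralZ ?sk ?snk//; [ring|ctsf|ctsf].
  apply: eq_period_integral => x; rewrite wave_datumE /wave_re /wave_im /=.
  have [-> ->] := ph x.
  have cs := cos2Dsin2 (k%:~R * x); rewrite !expr2 in cs.
  transitivity (- e * sin (k%:~R * x) + e * b * sin ((n%:Z - k)%:~R * x) *
    (cos (k%:~R * x) * cos (k%:~R * x) + sin (k%:~R * x) * sin (k%:~R * x))).
    by ring.
  by rewrite cs mulr1.
case: (fourier_coef _ _) Er Ei => a c /= -> ->.
rewrite /delta_coef; case: (k == 0); case: (k == n%:Z) => /=;
  apply/eqP; rewrite eq_complex /=; apply/andP; split; apply/eqP; ring.
Qed.

End WaveDatum.

(** * The flow map *)

Section FlowMap.
Context {R : realType} (r : \bar R) (r1 : (1 <= r)%E) (s T : R).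
Hypothesis T_gt0 : 0 < T.
Variables (S : FL s r1 -> R -> FL s r1) (t : R).
Hypotheses (hS : flow_map s r r1 T S) (tT : `|t| < T).
Local Notation C := (Rcomplex R).

Definition two_modes (n : nat) (b : R) : FL s r1 :=
  FL_delta s r1 0 1 + FL_delta s r1 n%:Z (b +i* 0)%C.

(** The imaginary part of [exp(i n^4 t)] times the [n]-th coefficient, which undoes the linear flow.
    The double sign matches the form [a Im - b Re] of [FL_coef_bounded]. *)
Definition rotated_coef (n : nat) (v : FL s r1) : R :=
  cos (n%:R ^+ 4 * t) * complex.Im (v n%:Z) -
  - sin (n%:R ^+ 4 * t) * complex.Re (v n%:Z).

Lemma flow_asymptotics (n : nat) (b : R) : (0 < n)%N -> 0 <= b ->
  exists C, forall e, 0 <= e <= 1 ->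
    `|rotated_coef n (S (e *: two_modes n b) t) + resonance n b * t * e ^+ 3| <= C * e ^+ 4.
Proof.
move=> n0 b0; exists ((2 * pi)^-1 * (resonance_error n b T * T)) => e e01.
have datum : (e *: two_modes n b : FL s r1) =1 fourier_coef (wave_datum n b e).
  by move=> k; rewrite fourier_wave_datum.
have sm : smooth (wave_datum n b e) by exact: smooth_trig.
have pe : Defs.periodic (wave_datum n b e) by exact: periodic_trig.
have [u [cu u0 uS]] := hS.2 _ _ sm pe datum.
have sol := classical_real_solution cu.
have pi2 := @twopi_gt0 R.
have init x : complex.Re (derive1n 0 (u 0) x) = wave_re n b e 0 x /\
    complex.Im (derive1n 0 (u 0) x) = wave_im n b e 0 x.
  by rewrite derive1n0 u0 wave_datumE.
have := resonant_mode_asymptotics n0 b0 e01 T_gt0 sol init tT.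
set m := mode _ _ _ _ _ => asym.
have [cp cq] := @rs_continuous _ _ _ _ _ _ sol 0%N isT.
have {}cp := strip_continuous_snd cp tT; have {}cq := strip_continuous_snd cq tT.
have [nc ns] := continuous_scaled (n%:Z%:~R : R).
have -> : rotated_coef n (S (e *: two_modes n b) t) = (2 * pi)^-1 * m.
  rewrite /rotated_coef uS//; have [-> ->] := fourier_coef_components (u t) n%:Z.
  rewrite mulrCA [- sin _ * _]mulrCA -mulrBr; congr (_ * _).
  rewrite -!period_integralZ -?period_integralB; try by ctsf.
  apply: eq_period_integral => x; have [-> ->] := phase_pihalf n t x.
  have -> : phase n 0 t x = n%:Z%:~R * x - n%:R ^+ 4 * t :> R.
    by rewrite /phase addr0 mulNr -pmulrn.
  by rewrite cosB sinB; ring.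
rewrite (_ : _ + _ = (2 * pi)^-1 * (m + 2 * pi * (e ^+ 3 * resonance n b) * t)); last first.
  by move: pi2; move: (2 * pi : R) => P P0; field; rewrite gt_eqF.
have ipi : 0 <= (2 * pi)^-1 :> R by rewrite invr_ge0 ltW.
by rewrite normrM (ger0_norm ipi) -[leRHS]mulrA (ler_wpM2l ipi).
Qed.

Lemma two_modes_norm (n : nat) :
  `|two_modes n (bracket n%:Z `^ s)^-1| <= 2.
Proof.
have B0 : 0 < bracket n%:Z `^ s :> R by rewrite powR_gt0// bracket_gt0.
rewrite (le_trans (ler_normD _ _))// -[2]/(1 + 1) lerD//.
  rewrite (le_trans (FL_delta_norm _ _ _ _))// Rcomplex_normE/= expr1n expr0n/= addr0.
  by rewrite /bracket expr0n/= addr0 sqrtr1 powR1 mulr1.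
rewrite (le_trans (FL_delta_norm _ _ _ _))// Rcomplex_normE/= expr0n/= addr0.
by rewrite sqrtr_sqr ger0_norm ?invr_ge0 ?(ltW B0)// mulfV// gt_eqF.
Qed.

End FlowMap.

Theorem theorem3p8 (R : realType) (r : \bar R) (r1 : (1 <= r)%E) (s T : R)
    (hT : 0 < T) (S : FL s r1 -> R -> FL s r1) (hS : flow_map s r r1 T S)
    (t : R) (ht : `|t| < T) (t0 : t != 0) :
  ~ Cn 3 (fun u0 : FL s r1 => S u0 t).
Proof.
move=> /Cn3_third_difference[K [K0 [d [d0 diff3]]]].
have nt0 : 0 < `|t| by rewrite normr_gt0.
(* On the left [8 = 2^3] is the cubed bound on the norm of the datum; on the right [48 = 6 * 8],
   where [6] is the third difference of [e^3] at unit step and [8 n^2 b] is the first term of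
   [resonance]. *)
have [n n0 nK] : exists2 n : nat, (0 < n)%N & 8 * K < 48 * `|t| * (n%:R * n%:R).
  pose n := (Num.truncn (8 * K / (48 * `|t|))).+1.
  have n1 : 1 <= n%:R :> R by rewrite ler1n.
  exists n => //; rewrite -ltr_pdivrMl ?mulr_gt0// mulrC.
  have : 8 * K / (48 * `|t|) < n%:R by exact: truncnS_gt.
  by move=> /lt_le_trans; apply; rewrite ler_peMr.
(* With [b = B^-1] both modes of the datum have norm 1, for every sign of [s]. *)
set B : R := bracket n%:Z `^ s.
have B0 : 0 < B by rewrite powR_gt0// bracket_gt0.
have B0' : 0 <= B^-1 by rewrite invr_ge0 ltW.
have [C asym] := flow_asymptotics hT hS ht n0 B0'.
set g := fun e : R => rotated_coef t n (S (e *: two_modes r1 s n B^-1) t) in asym *.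
have bd : bounded_functional B^-1 (@rotated_coef R r r1 s t n).
  by apply: FL_coef_bounded; rewrite sqrrN cos2Dsin2.
have Phi2 := two_modes_norm r1 s n; rewrite -/B in Phi2.
set Phi := two_modes r1 s n B^-1 in g asym Phi2 *.
have delta e : 0 <= e -> 6 * e < d ->
    `|g (3 * e) - 3 * g (2 * e) + 3 * g e - g 0| <= K * B^-1 * 8 * e ^+ 3.
  move=> e0 ed; apply: (le_trans (diff3 _ _ Phi e bd e0 _)).
    rewrite (le_lt_trans _ ed)// (le_trans (ler_wpM2l _ Phi2)) ?mulr_ge0//; lra.
  rewrite -[leRHS]mulrA ler_wpM2l ?mulr_ge0 ?(ltW K0)// exprMn ler_wpM2r ?exprn_ge0//.
  have -> : 8 = 2 ^+ 3 :> R by rewrite -natrX.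
  by rewrite lerXn2r ?nnegrE.
have kappa0 : 0 <= resonance n B^-1 by rewrite /resonance !(addr_ge0, mulr_ge0).
have gap : 8 * K * B^-1 < 6 * (resonance n B^-1 * `|t|).
  have h : 8 * (n%:R * n%:R * B^-1) <= resonance n B^-1 by rewrite lerDl !mulr_ge0.
  rewrite (@lt_le_trans _ _ (48 * `|t| * (n%:R * n%:R) * B^-1)) ?ltr_pM2r ?invr_gt0//.
  by have := ler_wpM2r (ltW nt0) h; lra.
pose eta := 6 * (resonance n B^-1 * `|t|) - 8 * K * B^-1.
have eta0 : 0 < eta by rewrite subr_gt0.
(* [132 = 3^4 + 3 * 2^4 + 3] collects the errors [O(e^4)] at the nodes of the third difference; the
   [+ 1] makes the final inequality strict. *)
have M0 : 0 < 132 * `|C| + 1 by rewrite ltr_wpDl ?mulr_ge0.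
(* The three bounds give [3 e <= 1] for the asymptotics, [6 e < d] for the third difference ([7] for
   strictness), and an error below the gap [eta]. *)
pose e := Num.min (3^-1) (Num.min (d / 7) (eta / (132 * `|C| + 1))).
have e0 : 0 < e by rewrite !lt_min invr_gt0 ltr0n !divr_gt0 ?ltr0n.
have e3 : e <= 3^-1 by rewrite ge_min lexx.
have ed : e <= d / 7 by rewrite !ge_min lexx orbT.
have eeta : (132 * `|C| + 1) * e <= eta by rewrite mulrC -ler_pdivlMr// !ge_min lexx !orbT.
have ee0 : 0 <= e := ltW e0.
have bnd (k : R) : 0 <= k <= 3 ->
    `|g (k * e) + resonance n B^-1 * t * (k * e) ^+ 3| <= `|C| * (k * e) ^+ 4.
  move=> /andP[k0 k3]; rewrite (le_trans (asym _ _))//.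
    rewrite mulr_ge0//= (le_trans (ler_pM k0 ee0 k3 e3))// mulfV// pnatr_eq0.
  by rewrite ler_wpM2r ?exprn_ge0 ?mulr_ge0// ler_norm.
have [b3 b2 b1 b0] : [/\ 0 <= (3 : R) <= 3, 0 <= (2 : R) <= 3, 0 <= (1 : R) <= 3 &
    0 <= (0 : R) <= 3].
  by split; rewrite ?lexx ?ler01 ?ler0n ?ler1n ?ler_nat.
have e6 : 6 * e < d by move: ed d0 ee0; rewrite ler_pdivlMr//; lra.
have := delta e ee0 e6; have := bnd 3 b3; have := bnd 2 b2; have := bnd 1 b1.
have := bnd 0 b0; rewrite mul0r mul1r => h0 h1 h2 h3 hd.
(* The coefficient is [3^3 - 3 * 2^3 + 3 = 6]. *)
have total : `|6 * (resonance n B^-1 * t * e ^+ 3)|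
    <= K * B^-1 * 8 * e ^+ 3 + 132 * `|C| * e ^+ 4.
  move: h0 h1 h2 h3 hd; rewrite !exprMn expr0n/= !mulr0 addr0 !ler_norml.
  move=> /andP[? ?] /andP[? ?] /andP[? ?] /andP[? ?] /andP[? ?].
  by apply/andP; split; lra.
have E3 : 0 < e ^+ 3 by rewrite exprn_gt0.
have : 6 * (resonance n B^-1 * `|t|) <= K * B^-1 * 8 + 132 * `|C| * e.
  rewrite -(ler_pM2r E3); move: total.
  rewrite (_ : 6 * _ = 6 * resonance n B^-1 * e ^+ 3 * t); last by ring.
  rewrite normrM ger0_norm; last by rewrite !mulr_ge0 ?(ltW E3).
  by rewrite [e ^+ 4]exprSr; lra.
by move: eeta; rewrite /eta; lra.
Qed.
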